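(* Let $G$ be a simple connected simply-connected complex Lie group with Lie algebra $\mathfrak g$, and fix a compact real form $\mathfrak k\subset\mathfrak g$. Let $\mathcal O\subset\mathfrak g$ be a nonzero nilpotent $\mathrm{Ad}(G)$-orbit. Then $\mathcal O$ is a Moore--Penrose orbit if and only if $\mathrm{ht}(\mathcal O)=2$. In this case, for any $e\in\mathcal O$ there exists a unique $\mathfrak{sl}_2$-triple $\langle e,h,f\rangle$ such that $h\in i\mathfrak k$.
   Context: An $\mathfrak{sl}_2$-triple $\langle e,h,f\rangle$ in a Lie algebra is a triple of (possibly zero) elements with $[e,f]=h$, $[h,e]=2e$, $[h,f]=-2f$. Definition. A nilpotent orbit $\mathcal O\subset\mathfrak g$ is called a Moore--Penrose orbit if for any $e\in\mathcal O$ there exists an $\mathfrak{sl}_2$-triple $\langle e,h,f\rangle$ such that $h\in i\mathfrak k$. The height $\mathrm{ht}(\mathcal O)$ of a nilpotent orbit $\mathcal O=\mathrm{Ad}(G)e$ is the maximal integer $k$ such that $\mathrm{ad}(e)^k\neq0$. *)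

(* Defs.v *)
(* The complex numbers are R[i] for R : realType. *)
From HB Require Import structures.
From mathcomp Require Import all_boot all_order all_algebra.
From mathcomp Require Import complex.
From mathcomp Require Import all_classical all_reals topology normedtype derive.

Set Implicit Arguments.
Unset Strict Implicit.
Unset Printing Implicit Defensive.

Import Order.TTheory GRing.Theory Num.Theory.
Import numFieldNormedType.Exports.

Local Open Scope classical_set_scope.
Local Open Scope ring_scope.
Local Open Scope complex_scope.

(* The two structures are only put on the same carrier here: continuity of the
   group operations is part of [complex_Lie_group] below. *)
#[short(type="groupTopologicalType")]
HB.structure Definition GroupTopological := {G of Group G & Topological G}.

Record chart (K : numFieldType) (M : topologicalType) (V : normedModType K) :=
  Chart {
    chart_dom : set M;
    chart_map :> M -> V;
    chart_inv : V -> M;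
    chart_dom_open : open chart_dom;
    chart_img_open : open (chart_map @` chart_dom);
    chart_mapK : {in chart_dom, cancel chart_map chart_inv};
    chart_map_continuous : {in chart_dom, continuous chart_map};
    chart_inv_continuous : {in chart_map @` chart_dom, continuous chart_inv}
  }.

(* Over K = R[i], [differentiable] means complex differentiable, and a map is
   holomorphic when it is so at every point of an open set.  Outside
   [chart_map @` chart_dom] the values of [chart_inv] are junk, but only germs
   at points of that open set are used. *)
Definition holomorphic_atlas (K : numFieldType) (M : topologicalType)
    (V : normedModType K) (A : set (chart M V)) : Prop :=
  (forall x : M, exists2 c, A c & chart_dom c x) /\
  (forall (c d : chart M V) (x : M), A c -> A d ->
     chart_dom c x -> chart_dom d x ->
     differentiable (d \o chart_inv c) (c x)).

Record complex_Lie_group (R : realType) (n : nat) (G : groupTopologicalType)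
    (A : set (chart G 'rV[R[i]]_n)) : Prop := {
  Lie_group_hausdorff : hausdorff_space G;
  Lie_group_second_countable : @second_countable G;
  Lie_group_atlas : holomorphic_atlas A;
  Lie_group_mul_continuous : continuous (fun p : G * G => (p.1 * p.2)%g);
  Lie_group_mul_holomorphic :
    forall (c1 c2 c3 : chart G 'rV[R[i]]_n) (x y : G), A c1 -> A c2 -> A c3 ->
    chart_dom c1 x -> chart_dom c2 y -> chart_dom c3 (x * y)%g ->
    differentiable
      (fun p : 'rV[R[i]]_n * 'rV[R[i]]_n =>
         c3 (chart_inv c1 p.1 * chart_inv c2 p.2)%g) (c1 x, c2 y);
  Lie_group_inv_continuous : continuous (fun x : G => (x^-1)%g);
  Lie_group_inv_holomorphic :
    forall (c1 c2 : chart G 'rV[R[i]]_n) (x : G), A c1 -> A c2 ->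
    chart_dom c1 x -> chart_dom c2 (x^-1)%g ->
    differentiable (fun u : 'rV[R[i]]_n => c2 ((chart_inv c1 u)^-1)%g) (c1 x)
}.

Definition simply_connected (R : realType) (T : topologicalType) : Prop :=
  (forall x y : T, exists p : R -> T,
     [/\ {within `[0, 1], continuous p}, p 0 = x & p 1 = y]) /\
  (forall p : R -> T, {within `[0, 1], continuous p} -> p 0 = p 1 ->
     exists H : R * R -> T,
       [/\ {within `[0, 1] `*` `[0, 1], continuous H},
           forall t, t \in `[0, 1] -> H (t, 0) = p t,
           forall t, t \in `[0, 1] -> H (t, 1) = p 0 &
           forall s, s \in `[0, 1] -> H (0, s) = p 0 /\ H (1, s) = p 0]).

Record lieAlgebra (K : fieldType) := LieAlgebra {
  lie_sort :> vectType K;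
  lie : lie_sort -> lie_sort -> lie_sort;
  lie_linearl : forall y, linear (lie ^~ y);
  lie_linearr : forall x, linear (lie x);
  liexx : forall x, lie x x = 0;
  lie_jacobi : forall x y z,
    lie x (lie y z) + lie y (lie z x) + lie z (lie x y) = 0
}.

Definition simple_Lie_algebra (K : fieldType) (g : lieAlgebra K) : Prop :=
  (exists x y : g, lie x y != 0) /\
  (forall I : {vspace g}, (forall x y : g, y \in I -> lie x y \in I) ->
     I = 0%VS \/ I = fullv).

Definition killing (K : fieldType) (g : lieAlgebra K) (x y : g) : K :=
  \sum_(i < \dim {:g})
    coord (vbasis {:g}) i (lie x (lie y (vbasis {:g})`_i)).

(* A real basis of a real form k is a complex basis of g, so the Killing form of
   the real Lie algebra k is the restriction of that of g; on a real form of a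
   semisimple algebra, compactness of k is negative definiteness of this form.
   In R[i], [z < 0] says that z is real and negative. *)
Record compact_real_form (R : realType) (g : lieAlgebra R[i]) (k : set g) :
    Prop := {
  real_form0 : k 0;
  real_form_linear : forall (a : R) (x y : g),
    k x -> k y -> k (a%:C *: x + y);
  real_form_lie : forall x y : g, k x -> k y -> k (lie x y);
  real_form_complexification : forall z : g,
    exists! p : g * g, [/\ k p.1, k p.2 & z = p.1 + 'i *: p.2];
  real_form_compact : forall x : g, k x -> x != 0 -> killing x x < 0
}.

Section AdjointAction.
Variables (R : realType) (n : nat) (G : groupTopologicalType).

(* Ad(a) : T_1 G -> T_1 G is the differential at 1 of b |-> a b a^-1; the
   tangent space T_1 G is read in the chart c as 'rV[R[i]]_n. *)
Definition Adjoint (c : chart G 'rV[R[i]]_n) (a : G) :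
    'rV[R[i]]_n -> 'rV[R[i]]_n :=
  'd (fun v : 'rV[R[i]]_n => c (a * chart_inv c v * a^-1)%g) (c 1%g).

(* Identification of g with the Lie algebra T_1 G of G, whose bracket is
   given by ad = d(Ad)_1. *)
Record Lie_algebra_of (A : set (chart G 'rV[R[i]]_n)) (g : lieAlgebra R[i]) := {
  chart1 : chart G 'rV[R[i]]_n;
  to_tangent : {linear g -> 'rV[R[i]]_n};
  chart1_atlas : A chart1;
  chart1_dom : chart_dom chart1 1%g;
  to_tangent_bij : bijective to_tangent;
  Adjoint_differentiable : forall y : g,
    differentiable
      (fun u => Adjoint chart1 (chart_inv chart1 u) (to_tangent y))
      (chart1 1%g);
  diff_Adjoint : forall x y : g,
    'd (fun u => Adjoint chart1 (chart_inv chart1 u) (to_tangent y))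
       (chart1 1%g) (to_tangent x)
    = to_tangent (lie x y)
}.

Variables (A : set (chart G 'rV[R[i]]_n)) (g : lieAlgebra R[i]).

Definition Ad_orbit (T : Lie_algebra_of A g) (e : g) : set g :=
  [set y | exists a : G,
     to_tangent T y = Adjoint (chart1 T) a (to_tangent T e)].

Definition ad_nilpotent (e : g) : Prop :=
  exists m : nat, forall x : g, iter m (lie e) x = 0.

Definition nilpotent_orbit (T : Lie_algebra_of A g) (O : set g) : Prop :=
  exists2 e : g, ad_nilpotent e & O = Ad_orbit T e.

End AdjointAction.

Section Orbits.
Variables (R : realType) (g : lieAlgebra R[i]).

Definition sl2_triple (e h f : g) : Prop :=
  [/\ lie e f = h, lie h e = 2 *: e & lie h f = - 2 *: f].

Definition imaginary_form (k : set g) : set g := [set 'i *: x | x in k].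

Definition Moore_Penrose (k O : set g) : Prop :=
  forall e, O e -> exists h f, sl2_triple e h f /\ imaginary_form k h.

Definition max_ad_power (e : g) (m : nat) : Prop :=
  (exists x, iter m (lie e) x != 0) /\
  (forall m', (exists x, iter m' (lie e) x != 0) -> (m' <= m)%N).

(* The maximal power does not depend on the point e of the orbit; [get] is only
   meaningful on nilpotent orbits, where this maximum exists. *)
Definition ht (O : set g) : nat :=
  get [set m | exists2 e, O e & max_ad_power e m].

End Orbits.

(* Main.v *)
(* Write x^* = - sigma(x), where sigma is the conjugation of g fixing k, so that
   h lies in ik iff h^* = h, and (x, y) |-> K(x, y^* ) is a positive definite
   hermitian form (K the Killing form) for which ad(x^* ) is adjoint to ad(x).

   Height 2 suffices.  If ad(e)^3 = 0, a trace argument shows e in V := im ad(e)^2,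
   and ad(e)^2 is a bijection from its orthocomplemented kernel
   V^* = im ad(e^* )^2 onto V, so - 2e = ad(e)^2 f with f in V^*.  Then h = [e, f]
   acts by 2 on V; as V is an inner ideal, h preserves V^*, on which it must act by
   - 2, so that h^* also acts by 2 on V.  Hence h - h^*, an element of [V, V^*]
   killing V and V^*, is K-isotropic, and h = h^*.

   Height 2 is necessary.  Let ad(e)^m <> 0 = ad(e)^(m+1) with m >= 3, and let
   (e, h, f) be a triple with h = h^*.  Choose x of weight - m with
   ad(e)^m x <> 0 and put u = ad(e)^(m-1) x, of weight j = m - 2 > 0.  Move e along
   a curve a_t of G with velocity u.  The hermitian neutral element of Ad(a_t) e is
   Ad(a_t)(h + z) with z in ker ad(e) and im ad(e), and to first order it differs
   from h by z - t j u, which is K-isotropic; since K is definite on ik, this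
   vector is o(t), and applying ad(e) gives [e, u] = 0, a contradiction. *)
From HB Require Import structures.
Require Import Defs.
From mathcomp Require Import all_boot all_order all_algebra.
From mathcomp Require Import complex.
From mathcomp Require Import all_classical all_reals topology normedtype landau derive.
From mathcomp Require Import interval_inference.
From mathcomp Require Import ring lra.

Set Implicit Arguments.
Unset Strict Implicit.
Unset Printing Implicit Defensive.

Import Order.TTheory GRing.Theory Num.Theory.
Import numFieldNormedType.Exports.
Import Normc.

Local Open Scope classical_set_scope.
Local Open Scope ring_scope.
Local Open Scope complex_scope.

(** * Killing form and sl2 identities *)

(** Induction on the exponent through a full-rank factorization P = LN: tr(LN) = tr(NL), and P^(j+1)
    = L (NL)^j N lets L and N be cancelled, so NL has a smaller exponent. Eigenvalues are avoided,
    hence any field works. *)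
Lemma mxtrace_nilpotent (K : fieldType) (d m : nat) (P : 'M[K]_d) :
  P ^+ m = 0 -> \tr P = 0.
Proof.
elim: m d P => [|m IHm] d P Pm0.
  by rewrite -(mulr1 P) -[1 in LHS](expr0 P) Pm0 mulr0 raddf0.
pose L := col_base P; pose N := row_base P.
have PE : P = L *m N by rewrite mulmx_base.
have PX j : P ^+ j.+1 = L *m (N *m L) ^+ j *m N.
  elim: j => [|j IHj]; first by rewrite expr1 expr0 mulmx1.
  rewrite exprS IHj -mulmxE.
  have {1}-> : P *m (L *m (N *m L) ^+ j *m N) = L *m N *m (L *m (N *m L) ^+ j *m N).
    by rewrite -PE.
  by rewrite exprS -mulmxE !mulmxA.
rewrite PE mxtrace_mulC; apply: IHm.
apply: (row_full_inj (col_base_full P)); apply: (row_free_inj (row_base_free P)).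
by rewrite -PX Pm0 mulmx0 mul0mx.
Qed.

(* The second hypothesis says [X, [X, Y]] = 0; it forces (XY)^5 = 0. *)
Lemma mxtrace_mul_nil3 (K : numFieldType) (d : nat) (X Y : 'M[K]_d) :
  X * X * X = 0 -> X * X * Y - X * Y * X *+ 2 + Y * X * X = 0 ->
  \tr (X * Y) = 0.
Proof.
move=> X3 rXY; apply: (@mxtrace_nilpotent _ _ 5).
have XXY : X * X * Y = X * Y * X *+ 2 - Y * X * X.
  by apply/eqP; rewrite -subr_eq0 opprB addrCA addrC -rXY addrAC.
(* With a = XYXX and b = XXYX, multiplying the relation by X on the left and on the right gives a =
   2b and b = 2a, so both vanish in characteristic zero. *)
have E1 : X * Y * X * X = X * X * Y * X *+ 2.
  have := congr1 ( *%R X) rXY; rewrite mulr0 mulrDr mulrBr mulrnAr !mulrA X3.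
  by rewrite mul0r sub0r => /eqP; rewrite addrC subr_eq0 => /eqP.
have E2 : X * X * Y * X = X * Y * X * X *+ 2.
  have := congr1 ( *%R^~ X) rXY; rewrite /= mul0r mulrDl mulrBl mulrnAl.
  by rewrite -!(mulrA Y) X3 mulr0 addr0 => /eqP; rewrite subr_eq0 => /eqP.
have XXYX : X * X * Y * X = 0.
  have : X * X * Y * X *+ 3 = 0.
    by apply: (addrI (X * X * Y * X)); rewrite addr0 -mulrS [in RHS]E2 E1 -mulrnA.
  by move/eqP; rewrite -scaler_nat scaler_eq0 pnatr_eq0 => /eqP.
have XYXX : X * Y * X * X = 0 by rewrite E1 XXYX mul0rn.
have XYX : X * Y * X *+ 2 = X * X * Y + Y * X * X.
  by rewrite XXY subrK.
have XXYYXX : X * X * Y * Y * X * X = 0.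
  have -> : X * X * Y * Y * X * X = X * X * Y * (Y * X * X) by rewrite !mulrA.
  rewrite XXY mulrBl mulrnAl.
  have -> : X * Y * X * (Y * X * X) = X * Y * (X * Y * X * X) by rewrite !mulrA.
  have -> : Y * X * X * (Y * X * X) = Y * X * (X * Y * X * X) by rewrite !mulrA.
  by rewrite XYXX !mulr0 mul0rn subrr.
have P3 : (X * Y) * (X * Y) * (X * Y) *+ 2 = X * Y * Y * X * X * Y.
  have -> : X * Y * (X * Y) * (X * Y) *+ 2 = X * Y * (X * Y * X *+ 2) * Y.
    by rewrite mulrnAr mulrnAl !mulrA.
  by rewrite XYX mulrDr mulrDl !mulrA XYXX !mul0r add0r.
(* Two uses of 2 XYX = XXY + YXX, each dropping a term with factor XYXX, turn 4 (XY)^5 into a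
   product containing XXYYXX = 0. *)
have P5 : (X * Y) ^+ 5 *+ 4 = 0.
  have -> : (X * Y) ^+ 5 *+ 4
      = X * Y * (X * Y) * ((X * Y) * (X * Y) * (X * Y) *+ 2) *+ 2.
    by rewrite [in RHS]mulrnAr -mulrnA !exprS expr0 mulr1 !mulrA.
  rewrite P3; have -> : X * Y * (X * Y) * (X * Y * Y * X * X * Y) *+ 2
      = X * Y * (X * Y * X *+ 2) * Y * Y * X * X * Y.
    by rewrite mulrnAr !mulrnAl !mulrA.
  rewrite XYX mulrDr !mulrDl !mulrA XYXX !mul0r add0r.
  have -> : X * Y * Y * X * X * Y * Y * X * X * Y
      = X * Y * Y * (X * X * Y * Y * X * X) * Y by rewrite !mulrA.
  by rewrite XXYYXX mulr0 mul0r.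
by move/eqP: P5; rewrite -scaler_nat scaler_eq0 pnatr_eq0 => /eqP.
Qed.

Lemma coord_vbasis_inj (K : fieldType) (V : vectType K) (x y : V) :
  (forall i, coord (vbasis {:V}) i x = coord (vbasis {:V}) i y) -> x = y.
Proof.
move=> xy; rewrite (coord_vbasis (memvf x)) (coord_vbasis (memvf y)).
by apply: eq_bigr => i _; rewrite xy.
Qed.

Section CoordLinear.
Variables (K : fieldType) (V : vectType K) (n : nat) (X : n.-tuple V) (i : 'I_n).

Lemma coordD (x y : V) : coord X i (x + y) = coord X i x + coord X i y.
Proof. exact: linearD. Qed.

Lemma coordN (x : V) : coord X i (- x) = - coord X i x.
Proof. exact: linearN. Qed.

Lemma coordZ (c : K) (x : V) : coord X i (c *: x) = c * coord X i x.
Proof. exact: linearZ. Qed.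

Lemma coord_0 : coord X i 0 = 0.
Proof. exact: linear0. Qed.

End CoordLinear.

(** Vector identities become scalar ones coordinate by coordinate, where [ring] applies. *)
Ltac coord_ring :=
  apply: coord_vbasis_inj => ?; rewrite ?(coordD, coordN, coordZ, coord_0); ring.

Section LieAlgebra.
Variables (K : numFieldType) (g : lieAlgebra K).
Implicit Types x y z a b : g.

HB.instance Definition _ x :=
  GRing.isLinear.Build K g g *:%R (lie x) (@lie_linearr K g x).

Lemma lieDl x y z : lie (x + y) z = lie x z + lie y z.
Proof. by have := lie_linearl z 1 x y; rewrite !scale1r. Qed.

Lemma lie0l x : lie (0 : g) x = 0.
Proof. by apply: (addrI (lie 0 x)); rewrite -lieDl !addr0. Qed.

Lemma lieZl (c : K) x y : lie (c *: x) y = c *: lie x y.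
Proof. by have := lie_linearl y c x 0; rewrite !addr0 lie0l addr0. Qed.

Lemma lieNl x y : lie (- x) y = - lie x y.
Proof. by rewrite -scaleN1r lieZl scaleN1r. Qed.

Lemma lieBl x y z : lie (x - y) z = lie x z - lie y z.
Proof. by rewrite lieDl lieNl. Qed.

Lemma lieDr x y z : lie x (y + z) = lie x y + lie x z.
Proof. exact: linearD. Qed.

Lemma lieNr x y : lie x (- y) = - lie x y.
Proof. exact: linearN. Qed.

Lemma lieZr x (c : K) y : lie x (c *: y) = c *: lie x y.
Proof. exact: linearZ. Qed.

Lemma lieBr x y z : lie x (y - z) = lie x y - lie x z.
Proof. exact: linearB. Qed.

Lemma lie0r x : lie x 0 = 0.
Proof. exact: linear0. Qed.

Definition lieE := (lieDl, lieNl, lieZl, lie0l, lieDr, lieNr, lieZr, lie0r).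

Lemma lieC x y : lie x y = - lie y x.
Proof.
apply/eqP; rewrite -addr_eq0; have := liexx (x + y).
by rewrite lieDl !linearD /= !liexx add0r addr0 => ->.
Qed.

Lemma lie_derivation x y z : lie x (lie y z) = lie (lie x y) z + lie y (lie x z).
Proof.
have := lie_jacobi x y z; rewrite (lieC z x) linearN /= (lieC z (lie x y)).
by move=> /eqP; rewrite -addrA addr_eq0 opprD !opprK addrC => /eqP.
Qed.

Lemma iter_lieD n x y z :
  iter n (lie x) (y + z) = iter n (lie x) y + iter n (lie x) z.
Proof. by elim: n => //= n ->; rewrite linearD. Qed.

Lemma iter_lieZ n x (c : K) y : iter n (lie x) (c *: y) = c *: iter n (lie x) y.
Proof. by elim: n => //= n ->; rewrite linearZ. Qed.

Lemma iter_lie0 n x : iter n (lie x) 0 = 0.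
Proof. by elim: n => //= n ->; rewrite linear0. Qed.

Lemma iter_lie_eq0 m n x : (forall y, iter m (lie x) y = 0) -> (m <= n)%N ->
  forall y, iter n (lie x) y = 0.
Proof. by move=> xm0 /subnKC <- y; rewrite addnC iterD xm0 iter_lie0. Qed.

Lemma weight_iter e h (c : K) n x : lie h e = 2 *: e -> lie h x = c *: x ->
  lie h (iter n (lie e) x) = (c + 2 * n%:R) *: iter n (lie e) x.
Proof.
move=> he hx; elim: n => [|n IHn] /=; first by rewrite mulr0 addr0.
rewrite lie_derivation he IHn lieZl linearZ /= -scalerDl -addn1 natrD.
by congr (_ *: _); ring.
Qed.

(** Commutation of ad(e)^(n+1) past ad(f), by induction on n. It rests on [e, f] = h and [h, e] =
    2e, so that [hermitian_triple] can use it before [h, f] = - 2f is established. *)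
Lemma iter_sl2 e h f n x : lie e f = h -> lie h e = 2 *: e ->
  iter n.+1 (lie e) (lie f x) = lie f (iter n.+1 (lie e) x)
    + n.+1%:R *: iter n (lie e) (lie h x + n%:R *: x).
Proof.
move=> ef he; elim: n => [|n IHn].
  by rewrite /= lie_derivation ef scale1r scale0r addr0 addrC.
have hE m y : lie h (iter m (lie e) y)
    = iter m (lie e) (lie h y) + (2 * m%:R) *: iter m (lie e) y.
  elim: m => [|m IHm] /=; first by rewrite mulr0 scale0r addr0.
  rewrite lie_derivation he IHm lieZl linearD linearZ /=.
  rewrite ?lieE; coord_ring.
rewrite iterS IHn linearD /= lie_derivation ef -[lie e (iter n _ x)]/(iter n.+1 (lie e) x).
rewrite hE !linearZ /= !iter_lieD !iter_lieZ linearD linearZ /= -!iterS.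
rewrite ?lieE; coord_ring.
Qed.

(** In [iter_sl2] with n = m both powers ad(e)^(m+1) vanish, and m + 1 is invertible. In effect
    ad(h) acts by - m modulo ker ad(e)^m. *)
Lemma iter_top_weight e h f m : lie e f = h -> lie h e = 2 *: e ->
  (forall x, iter m.+1 (lie e) x = 0) ->
  forall x, iter m (lie e) (lie h x + m%:R *: x) = 0.
Proof.
move=> ef he em x; have := iter_sl2 m x ef he; rewrite !em linear0 add0r.
by move/esym/eqP; rewrite scaler_eq0 pnatr_eq0 => /eqP.
Qed.

(** For V = im ad(e)^2 this is the inner ideal property, [V, [V, g]] contained in V, with an
    explicit preimage under ad(e)^2. *)
Lemma lie2_inner_ideal e : (forall x, lie e (lie e (lie e x)) = 0) ->
  forall a b y, lie (lie e (lie e a)) (lie (lie e (lie e b)) y) =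
    lie e (lie e (lie a (lie (lie e (lie e b)) y)
                  + 2 *: lie (lie e a) (lie (lie e b) y))).
Proof.
move=> e3 a b y.
have d2 u v : lie e (lie e (lie u v))
    = lie (lie e (lie e u)) v + 2 *: lie (lie e u) (lie e v) + lie u (lie e (lie e v)).
  rewrite (lie_derivation e u) linearD /= (lie_derivation e (lie e u)).
  by rewrite (lie_derivation e u) ?lieE; coord_ring.
(* In the Leibniz expansion of ad(e)^3 [u, v] = 0 the extreme terms vanish and the two middle ones
   have coefficient 3. *)
have d3 u v : lie (lie e (lie e u)) (lie e v) = - lie (lie e u) (lie e (lie e v)).
  have := e3 (lie u v); rewrite (d2 u v) !linearD linearZ /=.
  rewrite (lie_derivation e (lie e (lie e u))) (lie_derivation e (lie e u)).
  rewrite (lie_derivation e u) !e3 lie0l linear0 => E.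
  have /eqP : 3 *: (lie (lie e (lie e u)) (lie e v)
                  + lie (lie e u) (lie e (lie e v))) = 0.
    by rewrite -[RHS]E ?lieE; coord_ring.
  by rewrite scaler_eq0 pnatr_eq0 /= addr_eq0 => /eqP.
(* That is, V is abelian. *)
have d4 u v : lie (lie e (lie e u)) (lie e (lie e v)) = 0.
  by rewrite d3 e3 linear0 oppr0.
pose p := lie (lie e (lie e b)) y.
have ep : lie e p = lie (lie e (lie e b)) (lie e y).
  by rewrite /p lie_derivation e3 lie0l add0r.
have eep : lie e (lie e p) = 0.
  by rewrite ep lie_derivation e3 lie0l add0r d4.
pose q := lie (lie e b) y.
have eeq : lie e (lie e q) = lie e p.
  by rewrite /q d2 e3 lie0l d3 ep d3 ?lieE; coord_ring.
rewrite -/p -/q !linearD !linearZ /= (d2 a p) eep linear0 (d2 (lie e a) q).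
rewrite e3 lie0l d3 eeq ?lieE; coord_ring.
Qed.

Definition admx x : 'M[K]_(\dim {:g}) :=
  \matrix_(i, j) coord (vbasis {:g}) i (lie x (vbasis {:g})`_j).

Lemma admxM x y :
  admx x *m admx y = \matrix_(i, j)
    coord (vbasis {:g}) i (lie x (lie y (vbasis {:g})`_j)).
Proof.
apply/matrixP=> i j; rewrite !mxE.
rewrite [in RHS](coord_vbasis (memvf (lie y (vbasis {:g})`_j))).
rewrite !linear_sum /=; apply: eq_bigr => l _.
by rewrite !linearZ /= !mxE mulrC.
Qed.

Lemma killingE x y : killing x y = \tr (admx x *m admx y).
Proof. by rewrite admxM /mxtrace; apply: eq_bigr => i _; rewrite mxE. Qed.

Lemma admx_lie x y : admx (lie x y) = admx x *m admx y - admx y *m admx x.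
Proof.
apply/matrixP=> i j; rewrite !admxM !mxE -linearB /=; congr (coord _ _ _).
by rewrite lie_derivation addrK.
Qed.

Lemma killingC x y : killing x y = killing y x.
Proof. by rewrite !killingE mxtrace_mulC. Qed.

Lemma killing_lie x y z : killing (lie x y) z = - killing y (lie x z).
Proof.
have trB (A B : 'M[K]_(\dim {:g})) : \tr (A - B) = \tr A - \tr B.
  exact: linearB.
rewrite !killingE !admx_lie mulmxBl mulmxBr !trB opprB !mulmxA.
by congr (_ - _); rewrite [RHS]mxtrace_mulC mulmxA.
Qed.

Lemma killingDr x y z : killing x (y + z) = killing x y + killing x z.
Proof.
rewrite /killing -big_split /=; apply: eq_bigr => i _.
by rewrite lieDl !linearD.
Qed.

Lemma killingZr (c : K) x y : killing x (c *: y) = c * killing x y.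
Proof.
rewrite /killing mulr_sumr; apply: eq_bigr => i _.
by rewrite lieZl !linearZ.
Qed.

Lemma killingDl x y z : killing (x + y) z = killing x z + killing y z.
Proof. by rewrite killingC killingDr !(killingC z). Qed.

Lemma killingZl (c : K) x y : killing (c *: x) y = c * killing x y.
Proof. by rewrite killingC killingZr killingC. Qed.

Lemma killingNr x y : killing x (- y) = - killing x y.
Proof. by rewrite -scaleN1r killingZr mulN1r. Qed.

Lemma killingNl x y : killing (- x) y = - killing x y.
Proof. by rewrite -scaleN1r killingZl mulN1r. Qed.

Lemma killing0r x : killing x 0 = 0.
Proof. by rewrite -(scale0r 0) killingZr mul0r. Qed.

Lemma killing0l x : killing 0 x = 0.
Proof. by rewrite killingC killing0r. Qed.

(** For X = ad(e) and Y = ad(x), [e, [e, x]] = 0 becomes the relation [X, [X, Y]] = 0 of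
    [mxtrace_mul_nil3]. Combined with positivity, this places e in im ad(e)^2. *)
Lemma killing_nil3 e : (forall x, lie e (lie e (lie e x)) = 0) ->
  forall x, lie e (lie e x) = 0 -> killing e x = 0.
Proof.
move=> e3 x eex; rewrite killingE; apply: mxtrace_mul_nil3.
  apply/matrixP=> i j; rewrite -!mulmxE admxM !mxE.
  transitivity (coord (vbasis {:g}) i (lie e (lie e (lie e (vbasis {:g})`_j))));
    last by rewrite e3 linear0.
  rewrite [in RHS](coord_vbasis (memvf (lie e (vbasis {:g})`_j))).
  rewrite !linear_sum /=; apply: eq_bigr => l _.
  by rewrite !linearZ /= !mxE mulrC.
have := congr1 admx eex; rewrite !admx_lie -!mulmxE.
have -> : admx 0 = 0 by apply/matrixP=> i j; rewrite !mxE lie0l linear0.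
move=> <-; rewrite mulmxBl mulmxBr !mulmxA mulr2n.
by rewrite !opprB opprD !addrA; apply/matrixP=> i j; rewrite !mxE; ring.
Qed.

End LieAlgebra.

(** * Real forms *)

Lemma complex_imaginaryE (R : realType) (a b : R) :
  a +i* b = a%:C + 'i * b%:C :> R[i].
Proof. exact: complexE. Qed.

Lemma complexNE (R : realType) (a : R) : (- a)%:C = - a%:C :> R[i].
Proof. exact: rmorphN. Qed.

Lemma mulii (R : realType) : 'i * 'i = -1 :> R[i].
Proof. by rewrite -expr2 sqr_i. Qed.

Section CompactRealForm.
Variables (R : realType) (g : lieAlgebra R[i]) (k : set g).
Hypothesis kP : compact_real_form k.
Implicit Types x y z a b : g.

Ltac coord_ring_i :=
  apply: coord_vbasis_inj => ?; rewrite ?(coordD, coordN, coordZ, coord_0);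
  ring: (mulii R).

(* [conjk x = - sigma x], where sigma is the conjugation of g with respect to k,
   so that [imaginary_form k] is the set of its fixed points. *)
Definition conjk x : g :=
  let p := xget (0, 0) [set p : g * g | [/\ k p.1, k p.2 & x = p.1 + 'i *: p.2]]
  in - p.1 + 'i *: p.2.

(** Uniqueness of the decomposition makes [xget] return the pair (a, b) itself. *)
Lemma conjkE a b : k a -> k b -> conjk (a + 'i *: b) = - a + 'i *: b.
Proof.
move=> ka kb; rewrite /conjk; set P := [set p | _].
have Pab : P (a, b) by [].
have [p [_ pU]] := real_form_complexification kP (a + 'i *: b).
by case: xgetP => [q _ Pq|/(_ _ Pab)//]; rewrite -(pU q) // (pU (a, b)).
Qed.

Lemma conjkP x : exists a b, [/\ k a, k b & x = a + 'i *: b].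
Proof.
by have [[a b] [[ka kb xE] _]] := real_form_complexification kP x; exists a, b.
Qed.

Lemma real_formD a b : k a -> k b -> k (a + b).
Proof. by move=> ka kb; have := real_form_linear kP 1 ka kb; rewrite scale1r. Qed.

Lemma real_formZ (c : R) a : k a -> k (c%:C *: a).
Proof.
by move=> ka; have := real_form_linear kP c ka (real_form0 kP); rewrite addr0.
Qed.

Lemma real_formN a : k a -> k (- a).
Proof. by move=> ka; have := real_formZ (-1) ka; rewrite rmorphN1 scaleN1r. Qed.

Lemma conjkD x y : conjk (x + y) = conjk x + conjk y.
Proof.
have [a [b [ka kb ->]]] := conjkP x; have [c [d [kc kd ->]]] := conjkP y.
rewrite addrACA -scalerDr !conjkE //; try exact: real_formD.
by coord_ring.
Qed.

Lemma conjkZ (c : R[i]) x : conjk (c *: x) = (c^*)%C *: conjk x.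
Proof.
have [a [b [ka kb ->]]] := conjkP x; case: c => p q.
have -> : (p +i* q) *: (a + 'i *: b)
    = (p%:C *: a + (- q)%:C *: b) + 'i *: (q%:C *: a + p%:C *: b).
  by rewrite complex_imaginaryE complexNE; coord_ring_i.
rewrite !conjkE //; try by apply: real_formD; apply: real_formZ.
by rewrite [(_ ^*)%C]complex_imaginaryE !complexNE; coord_ring_i.
Qed.

Lemma conjkN x : conjk (- x) = - conjk x.
Proof. by rewrite -scaleN1r conjkZ rmorphN1 scaleN1r. Qed.

Lemma conjkB x y : conjk (x - y) = conjk x - conjk y.
Proof. by rewrite conjkD conjkN. Qed.

Lemma conjk0 : conjk 0 = 0.
Proof. by rewrite -[X in conjk X](scale0r (0 : g)) conjkZ conjc0 scale0r. Qed.

Lemma conjkK x : conjk (conjk x) = x.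
Proof.
have [a [b [ka kb ->]]] := conjkP x.
by rewrite !conjkE ?opprK //; exact: real_formN.
Qed.

(** The conjugation sigma respects brackets; the sign in [conjk] makes it reverse them, as the
    adjoint of matrices does. *)
Lemma conjk_lie x y : conjk (lie x y) = lie (conjk y) (conjk x).
Proof.
have [a [b [ka kb ->]]] := conjkP x; have [c [d [kc kd ->]]] := conjkP y.
have kl := real_form_lie kP.
have lieE a1 b1 c1 d1 : lie (a1 + 'i *: b1) (c1 + 'i *: d1) =
    (lie a1 c1 - lie b1 d1) + 'i *: (lie a1 d1 + lie b1 c1).
  by rewrite lieDl !linearD !linearZ /= !lieZl; coord_ring_i.
rewrite lieE !conjkE //; try by apply: real_formD => //; try apply: real_formN; apply: kl.
rewrite lieE !lieNl !linearN /= (lieC c a) (lieC d b) (lieC c b) (lieC d a).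
coord_ring.
Qed.

Lemma imaginary_formP x : imaginary_form k x <-> conjk x = x.
Proof.
split=> [[b kb <-]|].
  by have := conjkE (real_form0 kP) kb; rewrite oppr0 !add0r.
have [a [b [ka kb ->]]] := conjkP x; rewrite conjkE // => /addIr ab.
exists b => //; suff -> : a = 0 by rewrite add0r.
have /eqP : 2 *: a = 0 by rewrite scaler_nat mulr2n -{1}ab addNr.
by rewrite scaler_eq0 pnatr_eq0 => /eqP.
Qed.

(** A negative element of R[i] is real, so compactness gives reality on the diagonal; polarization
    extends it to all pairs. *)
Lemma killing_real a b : k a -> k b -> exists r : R, killing a b = r%:C.
Proof.
have sq c : k c -> exists r : R, killing c c = r%:C.
  move=> kc; have [->|/(real_form_compact kP kc)] := eqVneq c 0.
    by exists 0; rewrite killing0l.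
  by rewrite ltcE /= => /andP[/eqP + _]; case: (killing c c) => u v /= <-; exists u.
move=> ka kb; have [r] := sq _ (real_formD ka kb).
have [s sE] := sq _ ka; have [t tE] := sq _ kb.
rewrite !killingDl !killingDr sE tE (killingC b a) => E.
exists ((r - s - t) / 2); move: E; case: (killing a b) => u v.
move=> [E1 E2]; apply/eqP; rewrite eq_complex /=; apply/andP; split; apply/eqP.
  by rewrite -E1; field.
lra.
Qed.

Lemma killing_conjk x y : killing (conjk x) (conjk y) = (killing x y)^*%C.
Proof.
have [a [b [ka kb ->]]] := conjkP x; have [c [d [kc kd ->]]] := conjkP y.
rewrite !conjkE // !killingDl !killingDr !killingNl !killingZl !killingNr !killingZr.
have [p ->] := killing_real ka kc; have [q ->] := killing_real ka kd.
have [r ->] := killing_real kb kc; have [s ->] := killing_real kb kd.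
by apply/eqP; rewrite eq_complex /=; apply/andP; split; apply/eqP; ring.
Qed.

Definition herm x y := killing x (conjk y).

Lemma hermC x y : herm y x = (herm x y)^*%C.
Proof. by rewrite /herm -killing_conjk conjkK killingC. Qed.

(** For x = a + ib the cross terms cancel by symmetry of the Killing form, leaving - K(a, a) - K(b,
    b). *)
Lemma herm_gt0 x : x != 0 -> 0 < herm x x.
Proof.
have [a [b [ka kb ->]]] := conjkP x => x0.
have -> : herm (a + 'i *: b) (a + 'i *: b) = - killing a a - killing b b.
  rewrite /herm conjkE // !killingDl !killingDr !killingZl !killingNr !killingZr.
  by rewrite mulrA mulii (killingC b a); ring.
have ge0 c : k c -> 0 <= - killing c c.
  move=> kc; have [->|/(real_form_compact kP kc)] := eqVneq c 0.
    by rewrite killing0l oppr0 lexx.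
  by rewrite oppr_ge0 => /ltW.
have [a0|/(real_form_compact kP ka) aa] := eqVneq a 0.
  have b0 : b != 0 by apply: contraNneq x0 => ->; rewrite a0 scaler0 addr0 eqxx.
  by apply: (ltr_wpDl (ge0 _ ka)); rewrite oppr_gt0; apply: (real_form_compact kP kb b0).
by apply: (ltr_pwDl _ (ge0 _ kb)); rewrite oppr_gt0.
Qed.

Lemma herm_eq0 x : herm x x = 0 -> x = 0.
Proof. by move=> xx; apply/eqP; apply/negPn/negP => /herm_gt0; rewrite xx ltxx. Qed.

Lemma herm_lie e x y : herm (lie e x) y = herm x (lie (conjk e) y).
Proof. by rewrite /herm killing_lie conjk_lie conjkK (lieC (conjk y)) killingNr. Qed.

End CompactRealForm.

(** * Triples with hermitian neutral element *)

Section AdjointOperators.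
Variables (R : realType) (g : lieAlgebra R[i]) (k : set g).
Hypothesis kP : compact_real_form k.
Implicit Types (x y z a b e h f : g) (D : 'End(g)).

Let adjoint D D' := forall x y, herm k (D x) y = herm k x (D' y).

Lemma herm0r x : herm k x 0 = 0.
Proof. by rewrite /herm (conjk0 kP) killing0r. Qed.

Lemma adjoint_sym D D' : adjoint D D' -> adjoint D' D.
Proof.
by move=> DD' x y; rewrite (hermC kP) (hermC kP (D y)) DD'.
Qed.

Lemma adjoint_img_ker D D' : adjoint D D' -> (limg D :&: lker D' = 0)%VS.
Proof.
move=> DD'; apply/eqP; rewrite -subv0; apply/subvP => z.
rewrite memv_cap => /andP[/memv_imgP[w _ zE]]; rewrite memv_ker => /eqP D'z.
by rewrite memv0; apply/eqP/(herm_eq0 kP); rewrite {1}zE DD' D'z herm0r.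
Qed.

Lemma adjoint_dim_img D D' : adjoint D D' -> (\dim (limg D') <= \dim (limg D))%N.
Proof.
move=> DD'; rewrite -(@limg_dim_eq _ _ _ D (limg D')).
  by apply: dimvS; apply: limgS; apply: subvf.
exact: adjoint_img_ker (adjoint_sym DD').
Qed.

(** im D and ker D' meet trivially, and rank D >= rank D' makes their dimensions fill the space. *)
Lemma adjoint_decomposition D D' : adjoint D D' ->
  forall v, exists w z, v = D w + z /\ D' z = 0.
Proof.
move=> DD' v; have : v \in (limg D + lker D')%VS.
  suff -> : (limg D + lker D' = fullv)%VS by apply: memvf.
  apply/eqP; rewrite eqEdim subvf /= dimv_disjoint_sum ?adjoint_img_ker //.
  have := limg_ker_dim D' fullv; rewrite capfv => <-.
  by rewrite addnC leq_add2r adjoint_dim_img //; apply: adjoint_sym.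
case/memv_addP => _ /memv_imgP[w _ ->] [z]; rewrite memv_ker => /eqP D'z ->.
by exists w, z.
Qed.

Lemma adjoint_lie e : adjoint (linfun (lie e)) (linfun (lie (conjk k e))).
Proof. by move=> x y; rewrite !lfunE /=; apply: herm_lie. Qed.

Lemma adjoint_lie2 e : adjoint (linfun (lie e) \o linfun (lie e))
  (linfun (lie (conjk k e)) \o linfun (lie (conjk k e))).
Proof. by move=> x y; rewrite !comp_lfunE /= !adjoint_lie. Qed.

Lemma hermitian_triple e : (forall x, lie e (lie e (lie e x)) = 0) ->
  exists h f, sl2_triple e h f /\ imaginary_form k h.
Proof.
move=> e3; pose e' := conjk k e.
have decomp v : exists w z, v = lie e (lie e w) + z /\ lie e' (lie e' z) = 0.
  have [w [z [vE ez]]] := adjoint_decomposition (adjoint_lie2 e) v.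
  by exists w, z; move: vE ez; rewrite !comp_lfunE !lfunE.
have decomp' v : exists w z, v = lie e' (lie e' w) + z /\ lie e (lie e z) = 0.
  have [w [z [vE ez]]] := adjoint_decomposition (adjoint_sym (adjoint_lie2 e)) v.
  by exists w, z; move: vE ez; rewrite !comp_lfunE !lfunE.
have conj_ee w : conjk k (lie e (lie e w)) = lie e' (lie e' (conjk k w)).
  by rewrite !(conjk_lie kP) -/e' (lieC _ e') (lieC _ e') lieNr opprK.
have conj_e'e' w : conjk k (lie e' (lie e' w)) = lie e (lie e (conjk k w)).
  by rewrite -[RHS](conjkK kP) conj_ee (conjkK kP).
(* The component z of e in ker ad(e')^2 vanishes: [conjk k z] lies in ker ad(e)^2, which is
   orthogonal to e by [killing_nil3] and to im ad(e)^2 by invariance. *)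
have [v eE] : exists v, e = lie e (lie e v).
  have [v [z [eE e'z]]] := decomp e; exists v.
  suff z0 : z = 0 by rewrite {1}eE z0 addr0.
  apply: (herm_eq0 kP).
  have zE : z = e - lie e (lie e v) by rewrite [X in X - _]eE addrAC subrr add0r.
  rewrite {1}zE /herm killingDl killingNl !killing_lie opprK.
  have ez : lie e (lie e (conjk k z)) = 0 by rewrite -conj_e'e' e'z (conjk0 kP).
  by rewrite ez killing0r subr0; apply: killing_nil3.
have [w [z [vE ez]]] := decomp' v.
(* Changing v modulo ker ad(e)^2 puts f in im ad(e')^2; the factor - 2 is what [h, e] = - [e,
   [e, f]] = 2e requires. *)
pose f := - 2 *: lie e' (lie e' w); pose h := lie e f.
have eef : lie e (lie e f) = - 2 *: e.
  by rewrite /f !lieZr [in RHS]eE vE !lieDr ez addr0.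
have he : lie h e = 2 *: e by rewrite lieC eef scaleNr opprK.
have eeh x : lie e (lie e (lie h x)) = - 2 *: lie e (lie e x).
  have /= := @iter_top_weight _ _ e h f 2 (erefl _) he e3 x.
  rewrite !lieDr !lieZr => /eqP; rewrite addr_eq0 => /eqP ->.
  by rewrite scaleNr.
have hee x : lie h (lie e (lie e x)) = 2 *: lie e (lie e x).
  rewrite lie_derivation he (lie_derivation h e) he !lieE eeh.
  coord_ring.
pose h' := conjk k h.
have f'E : conjk k f = lie e (lie e (conjk k (- 2 *: w))).
  by rewrite -conj_e'e' !lieZr.
have h'E : h' = lie (conjk k f) e' by rewrite /h' (conjk_lie kP).
(* Conjugate statement: h' = [conjk f, e'] preserves im ad(e)^2, since [conjk k f] lies in this
   inner ideal. *)
have hV' y : exists s, lie h (lie e' (lie e' y)) = lie e' (lie e' s).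
  have [s sE] : exists s, lie h' (lie e (lie e (conjk k y))) = lie e (lie e s).
    rewrite h'E f'E lieC lie2_inner_ideal // -!lieNr; eexists; reflexivity.
  exists (- conjk k s); rewrite -(conjkK kP (lie h _)) (conjk_lie kP) conj_e'e' -/h'.
  by rewrite lieC sE (conjkN kP) conj_ee !lieNr.
(* The difference of the two sides has the form ad(e')^2 q and is killed by ad(e)^2, the adjoint of
   ad(e')^2; hence it is zero. *)
have hV'2 y : lie h (lie e' (lie e' y)) = - 2 *: lie e' (lie e' y).
  have [s sE] := hV' y; apply/eqP; rewrite -subr_eq0 sE; apply/eqP.
  rewrite -lieZr -lieZr -lieBr -lieBr; set q := s - _; apply: (herm_eq0 kP).
  have -> : herm k (lie e' (lie e' q)) (lie e' (lie e' q))
      = herm k q (lie e (lie e (lie e' (lie e' q)))).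
    by rewrite !herm_lie // /e' !(conjkK kP).
  rewrite /q !lieBr !lieZr -sE eeh subrr.
  exact: herm0r.
have hf : lie h f = - 2 *: f by rewrite /f lieZr hV'2.
have h'ee x : lie h' (lie e (lie e x)) = 2 *: lie e (lie e x).
  have := congr1 (conjk k) (hV'2 (conjk k x)).
  rewrite (conjk_lie kP) conj_e'e' (conjkK kP) (conjkZ kP) lieC -/h' => E.
  rewrite -[LHS]opprK E -scaleNr conj_e'e' (conjkK kP); congr (_ *: _).
  by apply/eqP; rewrite eq_complex /=; apply/andP; split; apply/eqP; ring.
exists h, f; split=> //; apply/(imaginary_formP kP); rewrite -/h'.
have dee x : lie (h - h') (lie e (lie e x)) = 0 by rewrite lieBl hee h'ee subrr.
apply/esym/eqP; rewrite -subr_eq0; apply/eqP/(herm_eq0 kP).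
(* h - h' kills e and [conjk k f], both in im ad(e)^2, so by invariance it is orthogonal to h =
   [e, f] and to h' = [conjk f, e']. *)
have dh : killing (h - h') h = 0.
  by rewrite {2}/h killingC killing_lie lieC [in lie _ e]eE dee oppr0 killing0r oppr0.
have dh' : killing (h - h') h' = 0.
  by rewrite {2}h'E killingC killing_lie lieC f'E dee oppr0 killing0r oppr0.
by rewrite /herm (conjkB kP) -/h' (conjkK kP) killingDr killingNr dh dh' subr0.
Qed.

(** h - h' is hermitian and lies in both im ad(e) and ker ad(e), hence is isotropic and zero. Then w
    = f' - f lies in ker ad(e) while its adjoint x lies in im ad(e), so [herm k w w] = 0. *)
Lemma hermitian_triple_unique e h f h' f' :
  (forall x, lie e (lie e (lie e x)) = 0) ->
  sl2_triple e h f -> imaginary_form k h ->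
  sl2_triple e h' f' -> imaginary_form k h' -> h = h' /\ f = f'.
Proof.
move=> e3 [ef he hf] /(imaginary_formP kP) hk [ef' he' hf'] /(imaginary_formP kP) hk'.
have hh' : h = h'.
  apply/eqP; rewrite -subr_eq0; apply/eqP/(herm_eq0 kP).
  rewrite /herm (conjkB kP) hk hk' -{1}ef -{1}ef' -lieBr killing_lie.
  by rewrite lieBr (lieC e h) (lieC e h') he he' subrr killing0r oppr0.
split=> //; move: hf' ef'; rewrite -hh' => hf' ef'.
pose w := f' - f; pose x := conjk k w.
have ew : lie e w = 0 by rewrite lieBr ef ef' subrr.
have hw : lie h w = - 2 *: w by rewrite lieBr hf hf' scalerBr.
have hx : lie h x = 2 *: x.
  rewrite /x -{1}hk lieC -(conjk_lie kP) hw (conjkZ kP) -scaleNr; congr (_ *: _).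
  by apply/eqP; rewrite eq_complex /=; apply/andP; split; apply/eqP; ring.
have top := @iter_top_weight _ _ e h f 2 ef he e3.
have eex : lie e (lie e x) = 0.
  have /= := top x; rewrite hx -scalerDl !lieZr => /eqP.
  by rewrite scaler_eq0 -natrD pnatr_eq0 => /eqP.
have hfx : lie h (lie f x) = 0.
  by rewrite lie_derivation hf hx !lieE; coord_ring.
(* [iter_top_weight] at [f, x], of weight 0, and [iter_sl2] give 0 = ad(e)^2 [f, x] = 2 [e, [h, x] +
   x] = 6 [e, x]. *)
have ex : lie e x = 0.
  have /= := top (lie f x); rewrite hfx add0r !lieZr => /eqP.
  rewrite scaler_eq0 pnatr_eq0 /= => /eqP.
  have /= -> := iter_sl2 1 x ef he; rewrite eex lie0r add0r hx -scalerDl lieZr.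
  move/eqP; rewrite scalerA scaler_eq0 => /orP[|/eqP //].
  by rewrite -(natrD _ 2 1) -natrM pnatr_eq0.
have xE : x = 2^-1 *: lie e (lie f x).
  by rewrite lie_derivation ex lie0r addr0 ef hx scalerA mulVf ?scale1r //.
apply/eqP; rewrite eq_sym -subr_eq0 -/w; apply/eqP/(herm_eq0 kP).
rewrite /herm -/x xE killingZr killingC killing_lie ew killing0r oppr0.
exact: mulr0.
Qed.

End AdjointOperators.

(** * The adjoint representation *)

(** Identities between maps read in charts hold only near the base point, so differentials must be
    transferred along germs. *)
Lemma near_eq_diff (K : numFieldType) (V W : normedModType K) (f h : V -> W)
    (x : V) : {near x, f =1 h} -> differentiable f x ->
  differentiable h x /\ 'd h x = 'd f x :> (V -> W).
Proof.
move=> fh df; have fhx : f x = h x by apply: (nbhs_singleton fh).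
have dfE := diff_locally df.
have dhE : h \o shift x = cst (h x) + 'd f x +o_ 0 id.
  apply: eqaddoE; apply/eqaddoP => e e0.
  have /eqaddoP /(_ _ e0) := dfE.
  have : \forall y \near (0 : V), f (y + x) = h (y + x).
    rewrite (near_shift x) sub0r; near=> y; rewrite /= subrK.
    by near: y.
  apply: filterS2 => y fhy.
  by rewrite !fctE /= fhx fhy.
have dh : 'd h x = 'd f x :> (V -> W).
  by apply: diff_unique => //; apply: diff_continuous.
split=> //; apply/diff_locallyP; rewrite dh; split => //.
exact: diff_continuous.
Unshelve. all: by end_near.
Qed.

Lemma diff_directional (K : numFieldType) (V W : normedModType K) (f : V -> W)
    (x v : V) (eps : K) : differentiable f x -> 0 < eps ->
  exists2 del : K, 0 < del & forall t : K, `|t| < del ->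
    `|f (t *: v + x) - f x - t *: 'd f x v| <= eps * `|t|.
Proof.
(* The bound |v| + 1 in place of |v| covers v = 0. *)
move=> df eps0; have N0 : 0 < `|v| + 1 by rewrite ltr_wpDl.
have e0 : 0 < eps / (`|v| + 1) by rewrite divr_gt0.
have /eqaddoP /(_ _ e0) := diff_locally df.
move=> /nbhs_ballP[r /= r0 rf]; exists (r / (`|v| + 1)); first by rewrite divr_gt0.
move=> t; rewrite ltr_pdivlMr // => tr.
have /rf /= : ball 0 r (t *: v).
  rewrite -ball_normE /= sub0r normrN normrZ; apply: le_lt_trans tr.
  by rewrite ler_wpM2l // lerDl.
rewrite !fctE /= linearZ opprD addrA => /le_trans; apply; rewrite normrZ.
have -> : eps / (`|v| + 1) * (`|t| * `|v|) = eps * `|t| * (`|v| / (`|v| + 1)) by ring.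
rewrite ler_piMr ?mulr_ge0 ?(ltW eps0) // ler_pdivrMr // mul1r.
by rewrite lerDl.
Qed.

Section DiffFixpoint.
Variables (K : numFieldType) (V : normedModType K).
Implicit Types (f h F : V -> V) (x v : V).

Lemma diff_comp_fix f h F x v : differentiable f x -> differentiable h x ->
  h x = x -> {near x, f \o h =1 F} -> 'd F x v = 'd f x ('d h x v).
Proof.
move=> df dh hx fhF; have df' := df; rewrite -[X in differentiable _ X]hx in df'.
have [_ ->] := near_eq_diff fhF (differentiable_comp dh df').
by rewrite (diff_comp dh df') /= hx.
Qed.

(** Chain rule on both sides, ['d h x] being its own differential. This is the abstract form of the
    equivariance of the bracket under Ad. *)
Lemma diff_commute_fix f h F x v :
  differentiable f x -> differentiable h x -> differentiable F x -> h x = x ->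
  {near x, f \o h =1 'd h x \o F} -> 'd f x ('d h x v) = 'd h x ('d F x v).
Proof.
move=> df dh dF hx fhF; rewrite -(diff_comp_fix v df dh hx fhF).
have dd y : differentiable ('d h x) y.
  by apply: linear_differentiable; apply: diff_continuous.
rewrite (diff_comp dF (dd _)) /= diff_lin //; exact: diff_continuous.
Qed.

End DiffFixpoint.

Section AdjointRepresentation.
Variables (R : realType) (n : nat) (G : groupTopologicalType).
Variables (A : set (chart G 'rV[R[i]]_n)) (g : lieAlgebra R[i]).
Variable T : Lie_algebra_of A g.
Hypothesis GA : complex_Lie_group A.
Local Notation V := 'rV[R[i]]_n.
Let c := chart1 T.

Let cE : A c := chart1_atlas T.
Let c1 : chart_dom c 1%g := chart1_dom T.

Lemma chartVK (d : chart G V) x : chart_dom d x -> chart_inv d (d x) = x.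
Proof. by move=> dx; apply: chart_mapK; rewrite inE. Qed.

(** With D a chart domain, this allows that chart to be inverted at a [chart_inv c v] b for all v
    near the base point. *)
Lemma near_translate (D : set G) (a b : G) : open D -> D (a * b)%g ->
  \forall v \near c 1%g, D (a * chart_inv c v * b)%g.
Proof.
move=> Do Dab.
have inv1 : chart_inv c v @[v --> c 1%g] --> (1%g : G).
  rewrite -[X in _ --> X](chartVK c1).
  have := @chart_inv_continuous _ _ _ c => /(_ (c 1%g)); apply.
  by rewrite inE; exists 1%g.
have mulc := Lie_group_mul_continuous GA.
have av : (a * chart_inv c v)%g @[v --> c 1%g] --> (a * 1)%g.
  apply: (@cvg_comp _ _ _ (fun v => (a, chart_inv c v)) (fun p => (p.1 * p.2)%g)).
    exact: (cvg_pair (cvg_cst a) inv1).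
  exact: (mulc (a, 1%g)).
have avb : (a * chart_inv c v * b)%g @[v --> c 1%g] --> (a * 1 * b)%g.
  apply: (@cvg_comp _ _ _ (fun v => ((a * chart_inv c v)%g, b)) (fun p => (p.1 * p.2)%g)).
    exact: (cvg_pair av (cvg_cst b)).
  exact: (mulc ((a * 1)%g, b)).
apply: avb; apply: open_nbhs_nbhs; split=> //; by rewrite mulg1.
Qed.

Definition conj_chart (a : G) (v : V) : V := c (a * chart_inv c v * a^-1)%g.

Lemma conj_chart1 a : conj_chart a (c 1%g) = c 1%g.
Proof. by rewrite /conj_chart chartVK // mulg1 mulgV. Qed.

(** Conjugation is a left translation L into a chart around a, followed by a right translation Q
    back to c; each is the holomorphic product with one argument frozen. *)
Lemma differentiable_conj_chart a : differentiable (conj_chart a) (c 1%g).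
Proof.
have atlas := (Lie_group_atlas GA).1.
have [c2 Ac2 c2a] := atlas a; have [c4 Ac4 c4a] := atlas (a^-1)%g.
pose L v := c2 (a * chart_inv c v)%g.
pose Q w := c (chart_inv c2 w * a^-1)%g.
have dL : differentiable L (c 1%g).
  have := @Lie_group_mul_holomorphic _ _ _ _ GA c2 c c2 a 1%g Ac2 cE Ac2 c2a c1.
  rewrite mulg1 => /(_ c2a) dm.
  have -> : L = (fun p : V * V => c2 (chart_inv c2 p.1 * chart_inv c p.2)%g)
                \o (fun v => (c2 a, v)).
    by apply/funext => v; rewrite /L /= chartVK.
  apply: differentiable_comp; last exact: dm.
  by apply: differentiable_pair; [exact: differentiable_cst | exact: ex_diff].
have L1 : L (c 1%g) = c2 a by rewrite /L chartVK // mulg1.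
have dQ : differentiable Q (L (c 1%g)).
  rewrite L1.
  have := @Lie_group_mul_holomorphic _ _ _ _ GA c2 c4 c a (a^-1)%g Ac2 Ac4 cE c2a c4a.
  rewrite mulgV => /(_ c1) dm.
  have -> : Q = (fun p : V * V => c (chart_inv c2 p.1 * chart_inv c4 p.2)%g)
                \o (fun w => (w, c4 (a^-1)%g)).
    by apply/funext => w; rewrite /Q /= chartVK.
  apply: differentiable_comp; last exact: dm.
  by apply: differentiable_pair; [exact: ex_diff | exact: differentiable_cst].
have near_QL : {near c 1%g, Q \o L =1 conj_chart a}.
  have : \forall v \near c 1%g, chart_dom c2 (a * chart_inv c v * 1)%g.
    by apply: near_translate; [exact: chart_dom_open | rewrite mulg1].
  by apply: filterS => v; rewrite mulg1 => c2v; rewrite /= /Q /L chartVK.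
by have [] := near_eq_diff near_QL (differentiable_comp dL dQ).
Qed.

Lemma near_conj_chartVK a : \forall v \near c 1%g,
  chart_inv c (conj_chart a v) = (a * chart_inv c v * a^-1)%g.
Proof.
have : \forall v \near c 1%g, chart_dom c (a * chart_inv c v * a^-1)%g.
  by apply: near_translate; [exact: chart_dom_open | rewrite mulgV].
by apply: filterS => v cv; rewrite chartVK.
Qed.

Lemma AdjointM a b v : Adjoint c (a * b)%g v = Adjoint c a (Adjoint c b v).
Proof.
apply: (@diff_comp_fix _ _ (conj_chart a) (conj_chart b)).
- exact: differentiable_conj_chart.
- exact: differentiable_conj_chart.
- exact: conj_chart1.
apply: filterS (near_conj_chartVK b) => w bw.
by rewrite /= {1}/conj_chart bw /conj_chart invgM !mulgA.
Qed.

Lemma Adjoint1 v : Adjoint c 1%g v = v.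
Proof.
have near1 : {near c 1%g, id =1 conj_chart 1%g}.
  have : nbhs (c 1%g) (c @` chart_dom c).
    by apply: open_nbhs_nbhs; split; [exact: chart_img_open | exists 1%g].
  apply: filterS => _ [x cx <-].
  by rewrite /conj_chart mul1g invg1 mulg1 chartVK.
have did : differentiable (id : V -> V) (c 1%g) by exact: ex_diff.
have [_ d1] := near_eq_diff near1 did.
by apply: etrans (congr1 (@^~ v) d1) _; rewrite diff_val.
Qed.

(* [b |-> Ad(a) (Ad(b) y)] and [b |-> Ad(a b a^-1) (Ad(a) y)] have the same
   differential at 1. *)
Lemma Adjoint_lie a (x y x' y' : g) :
  to_tangent T x' = Adjoint c a (to_tangent T x) ->
  to_tangent T y' = Adjoint c a (to_tangent T y) ->
  to_tangent T (lie x' y') = Adjoint c a (to_tangent T (lie x y)).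
Proof.
move=> x'E y'E; rewrite -!(diff_Adjoint T) -/c.
pose F z u := Adjoint c (chart_inv c u) (to_tangent T z).
have dF z : differentiable (F z) (c 1%g) := Adjoint_differentiable T z.
rewrite x'E; apply: (@diff_commute_fix _ _ (F y') (conj_chart a) (F y)).
- exact: dF.
- exact: differentiable_conj_chart.
- exact: dF.
- exact: conj_chart1.
apply: filterS (near_conj_chartVK a) => u au.
transitivity (Adjoint c (a * chart_inv c u)%g (to_tangent T y)).
  rewrite -[LHS]/(Adjoint c (chart_inv c (conj_chart a u)) (to_tangent T y')).
  rewrite au y'E -AdjointM -mulgA mulVg mulg1; exact: erefl.
exact: AdjointM.
Qed.

(** [Adjoint] transported to g; as [to_tangent] is bijective, the default 0 is never met. *)
Definition Ad (a : G) (y : g) : g :=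
  xget 0 [set z | to_tangent T z = Adjoint c a (to_tangent T y)].

Lemma to_tangent_inj : injective (to_tangent T).
Proof. exact: bij_inj (to_tangent_bij T). Qed.

Lemma to_tangent_Ad a y : to_tangent T (Ad a y) = Adjoint c a (to_tangent T y).
Proof.
have [S _ TS] := to_tangent_bij T; rewrite /Ad; case: xgetP => [z -> //|].
by move=> /(_ (S (Adjoint c a (to_tangent T y)))) /=; rewrite TS.
Qed.

Lemma Ad_is_linear a : linear (Ad a).
Proof.
move=> r x y; apply: to_tangent_inj.
rewrite to_tangent_Ad [RHS]linearP !to_tangent_Ad linearP.
exact: (linearP ('d (conj_chart a) (c 1%g))).
Qed.

HB.instance Definition _ a := GRing.isLinear.Build R[i] g g *:%R (Ad a) (@Ad_is_linear a).

Lemma AdK a : cancel (Ad a) (Ad a^-1%g).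
Proof.
by move=> x; apply: to_tangent_inj; rewrite !to_tangent_Ad -AdjointM mulVg Adjoint1.
Qed.

Lemma AdVK a : cancel (Ad a^-1%g) (Ad a).
Proof. by move=> x; rewrite -{1}(invgK a) AdK. Qed.

Lemma Ad_lie a x y : Ad a (lie x y) = lie (Ad a x) (Ad a y).
Proof.
apply: to_tangent_inj; rewrite to_tangent_Ad.
by apply: esym; apply: Adjoint_lie; exact: to_tangent_Ad.
Qed.

Lemma Ad_orbitP e y : Ad_orbit T e y <-> exists a, y = Ad a e.
Proof.
split=> [[a yE]|[a ->]]; exists a; last exact: to_tangent_Ad.
by apply: to_tangent_inj; rewrite to_tangent_Ad.
Qed.

Lemma AdM a b x : Ad (a * b)%g x = Ad a (Ad b x).
Proof. by apply: to_tangent_inj; rewrite !to_tangent_Ad AdjointM. Qed.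

Lemma Ad1 x : Ad 1%g x = x.
Proof. by apply: to_tangent_inj; rewrite to_tangent_Ad Adjoint1. Qed.

(** The curve with velocity u is a straight line in the chart at 1, and [diff_Adjoint] gives its
    derivative on y as [u, y]. *)
Lemma Ad_first_order (u y : g) (eps : R[i]) : 0 < eps ->
  exists2 del : R[i], 0 < del & forall t : R[i], `|t| < del ->
    `|to_tangent T (Ad (chart_inv c (t *: to_tangent T u + c 1%g)) y
                    - y - t *: lie u y)| <= eps * `|t|.
Proof.
move=> eps0; pose F z := Adjoint c (chart_inv c z) (to_tangent T y).
have dF : differentiable F (c 1%g) := Adjoint_differentiable T y.
have [del del0 F1] := diff_directional (to_tangent T u) dF eps0.
exists del => // t /F1.
have -> : F (t *: to_tangent T u + c 1%g) - F (c 1%g) - t *: 'd F (c 1%g) (to_tangent T u)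
  = to_tangent T (Ad (chart_inv c (t *: to_tangent T u + c 1%g)) y - y - t *: lie u y).
  have -> : 'd F (c 1%g) (to_tangent T u) = to_tangent T (lie u y).
    exact: (diff_Adjoint T).
  have -> : F (c 1%g) = to_tangent T y by rewrite /F chartVK // Adjoint1.
  rewrite [RHS]linearB [to_tangent T (_ - y)]linearB to_tangent_Ad [in RHS]linearZ.
  exact: erefl.
exact: id.
Qed.

End AdjointRepresentation.

(** * Norm estimates *)

Section CoordinateNorm.
Variables (R : realType) (n : nat) (g : vectType R[i]).
Variable phi : {linear g -> 'rV[R[i]]_n}.
Hypothesis phi_bij : bijective phi.
Implicit Types x y z : g.

(** The norm of row vectors over R[i] takes values in R[i]; its real part allows estimates in the
    ordered field R. *)
Definition cnorm x : R := complex.Re `|phi x|.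

Lemma cnormE x : `|phi x| = (cnorm x)%:C.
Proof. by rewrite /cnorm RRe_real // ger0_real. Qed.

Lemma normcE_normr (a : R[i]) : `|a| = (normc a)%:C.
Proof. by []. Qed.

Lemma cnorm_ge0 x : 0 <= cnorm x.
Proof. by rewrite -ler0c -cnormE. Qed.

Lemma cnormD x y : cnorm (x + y) <= cnorm x + cnorm y.
Proof. by rewrite -lecR rmorphD /= -!cnormE linearD ler_normD. Qed.

Lemma cnormZ (a : R[i]) x : cnorm (a *: x) = normc a * cnorm x.
Proof.
apply: complexI; rewrite rmorphM /= -!cnormE linearZ /= normrZ.
by rewrite normcE_normr.
Qed.

Lemma cnorm0 : cnorm 0 = 0.
Proof. by apply: complexI; rewrite -cnormE linear0 normr0. Qed.

Lemma cnorm_eq0 x : cnorm x = 0 -> x = 0.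
Proof.
move=> x0; apply: (bij_inj phi_bij); rewrite linear0.
by apply/eqP; rewrite -normr_eq0 cnormE x0.
Qed.

Lemma normc_coord_le x i : normc (phi x 0 i) <= cnorm x.
Proof.
rewrite -lecR -cnormE -normcE_normr [leRHS]/Num.norm /= mx_normE -[leLHS]nngE num_le.
exact: (le_bigmax _ (fun ij => `|phi x ij.1 ij.2|%:nng) (0, i)).
Qed.

Lemma cnorm_coord x : cnorm x = 0 \/ exists i, cnorm x = normc (phi x 0 i).
Proof.
have [x0|x0] := eqVneq (cnorm x) 0; [by left | right].
have /mx_norm_neq0[[i j]] : mx_norm (phi x) != 0.
  rewrite -[mx_norm _]/(`|phi x|) cnormE; apply: contra x0 => /eqP x0.
  by apply/eqP/complexI.
rewrite -[mx_norm _]/(`|phi x|) cnormE (ord1 i) => /complexI xj.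
by exists j.
Qed.

Definition cbasis (i : 'I_n) : g := xget 0 [set z | phi z = delta_mx 0 i].

Lemma cbasisE x : x = \sum_i phi x 0 i *: cbasis i.
Proof.
have [S _ phiS] := phi_bij; apply: (bij_inj phi_bij).
rewrite linear_sum [LHS]row_sum_delta; apply: eq_bigr => i _.
rewrite linearZ /=; congr (_ *: _); rewrite /cbasis; case: xgetP => [z -> //|].
by move=> /(_ (S (delta_mx 0 i))) /=; rewrite phiS.
Qed.

Lemma cnorm_sum (F : 'I_n -> g) : cnorm (\sum_i F i) <= \sum_i cnorm (F i).
Proof.
elim/big_rec2: _ => [|i r x _ xr]; first by rewrite cnorm0.
by apply: le_trans (cnormD _ _) _; rewrite lerD2l.
Qed.

(** A bound on finitely many basis vectors becomes an operator bound. This makes the first-order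
    estimate of Ad uniform in the vector it is applied to. *)
Lemma cnorm_linear_le (L : {linear g -> g}) (e : R) :
  (forall i, cnorm (L (cbasis i)) <= e) ->
  forall x, cnorm (L x) <= n%:R * e * cnorm x.
Proof.
move=> Le x; rewrite {1}(cbasisE x) linear_sum; apply: le_trans (cnorm_sum _) _.
have -> : n%:R * e * cnorm x = \sum_(i < n) cnorm x * e.
  by rewrite sumr_const card_ord -mulr_natl; ring.
apply: ler_sum => i _; rewrite linearZ /= cnormZ.
by apply: ler_pM; rewrite ?cnorm_ge0 ?normc_coord_le // -ler0c -normcE_normr.
Qed.

Lemma cnorm_linear_bound (L : {linear g -> g}) :
  exists2 C, 0 <= C & forall x, cnorm (L x) <= C * cnorm x.
Proof.
exists (n%:R * \sum_i cnorm (L (cbasis i))).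
  by rewrite mulr_ge0 ?sumr_ge0 // => i _; apply: cnorm_ge0.
apply: cnorm_linear_le => i; rewrite (bigD1 i) //= lerDl sumr_ge0 // => j _.
exact: cnorm_ge0.
Qed.

Lemma normc_ge0 (a : R[i]) : 0 <= normc a.
Proof. by rewrite -ler0c -normcE_normr. Qed.

Lemma cnorm_functional_bound (f : g -> R[i]) : scalar f ->
  forall x, normc (f x) <= (\sum_i normc (f (cbasis i))) * cnorm x.
Proof.
move=> lf x; pose fM := GRing.isLinear.Build _ _ _ _ _ lf.
pose F : {linear g -> R[i] | *%R} := HB.pack f fM.
rewrite -[f]/(F : g -> R[i]) {1}(cbasisE x) linear_sum /= mulr_suml.
elim/big_rec2: _ => [|i r y _ yr]; first by rewrite normc0.
apply: le_trans (le_normcD _ _) _; apply: lerD => //.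
rewrite -[f]/(F : g -> R[i]) linearZ /= normcM mulrC ler_wpM2l ?normc_ge0 //.
exact: normc_coord_le.
Qed.

Lemma cnorm_bilinear_bound (B : g -> g -> R[i]) :
  (forall y, scalar (B ^~ y)) -> (forall x, scalar (B x)) ->
  exists2 C, 0 <= C & forall x y, normc (B x y) <= C * cnorm x * cnorm y.
Proof.
move=> Bl Br; pose C := \sum_i \sum_j normc (B (cbasis i) (cbasis j)).
have C0 : 0 <= C by rewrite sumr_ge0 // => i _; rewrite sumr_ge0 // => j _; apply: normc_ge0.
exists C => // x y; apply: le_trans (cnorm_functional_bound (Bl y) x) _.
rewrite -mulrA [X in _ <= _ * X]mulrC mulrA ler_wpM2r ?cnorm_ge0 //.
rewrite mulr_suml ler_sum // => i _; exact: cnorm_functional_bound.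
Qed.

End CoordinateNorm.

Section HermitianBound.
Variables (R : realType) (n : nat) (g : lieAlgebra R[i]) (k : set g).
Hypothesis kP : compact_real_form k.
Variable phi : {linear g -> 'rV[R[i]]_n}.
Implicit Types x y z : g.

Lemma herm_cauchy_schwarz x y :
  normc (herm k x y) ^+ 2 <= complex.Re (herm k x x) * complex.Re (herm k y y).
Proof.
have real z : exists2 r : R, 0 <= r & herm k z z = r%:C.
  have [->|/(herm_gt0 kP)] := eqVneq z 0; first by exists 0; rewrite ?herm0r.
  by rewrite ltcE /= => /andP[/eqP]; case: (herm k z z) => u v /= -> /ltW; exists u.
have [y0|y0] := eqVneq y 0.
  by rewrite y0 !(herm0r kP) normc0 expr0n /= mulr0.
have [b b0 bE] := real y; have [a a0 aE] := real x.
have bpos : 0 < b by have := herm_gt0 kP y0; rewrite bE ltcR.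
pose s := herm k x y.
(* The component of x orthogonal to y, multiplied by b to avoid a division. *)
have [r r0] := real (b%:C *: x - s *: y).
have -> : herm k (b%:C *: x - s *: y) (b%:C *: x - s *: y)
   = b%:C * (b%:C * a%:C - s * conjc s).
  rewrite /herm (conjkB kP) !(conjkZ kP) killingDl !killingDr !killingNl !killingNr.
  rewrite !killingZl !killingZr -/(herm k x x) -/(herm k x y) -/(herm k y x) -/(herm k y y).
  by rewrite conjc_real (hermC kP x y) -/s bE aE; ring.
have -> : s * conjc s = (normc s ^+ 2)%:C.
  rewrite rmorphXn /= -normcE_normr -add_Re2_Im2.
  by case: s => u v; simpc; congr (_ +i* _); ring.
rewrite -rmorphM -rmorphB -rmorphM => /complexI E.
rewrite aE bE /= -subr_ge0; move: r0; rewrite -E pmulr_rge0 //.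
by rewrite [a * b]mulrC.
Qed.

Lemma scalar_vbasisE (f : g -> R[i]) : scalar f ->
  forall x, f x = \sum_i coord (vbasis {:g}) i x * f (vbasis {:g})`_i.
Proof.
move=> lf x; pose fM := GRing.isLinear.Build _ _ _ _ _ lf.
pose F : {linear g -> R[i] | *%R} := HB.pack f fM.
rewrite -[f]/(F : g -> R[i]) {1}(coord_vbasis (memvf x)) linear_sum /=.
by apply: eq_bigr => i _; rewrite -[f]/(F : g -> R[i]) linearZ.
Qed.

Lemma killing_scalarl (y : g) : scalar (fun x : g => killing x y).
Proof. by move=> a x z; rewrite killingDl killingZl. Qed.

Lemma killing_scalarr (x : g) : scalar (fun y : g => killing x y).
Proof. by move=> a y z; rewrite killingDr killingZr. Qed.

(** The Gram matrix of the Killing form is invertible, since a null vector x would satisfy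
    [herm k x x] = 0. Solving for the bilinear form and applying [conjk] yields the hermitian
    representative. *)
Lemma herm_riesz (f : g -> R[i]) : scalar f -> exists y, forall x, f x = herm k x y.
Proof.
move=> lf; pose b := vbasis {:g}.
pose gram : 'M[R[i]]_(\dim {:g}) := \matrix_(i, j) killing b`_i b`_j.
have gramE (v : 'rV_(\dim {:g})) j : (v *m gram) 0 j = killing (\sum_i v 0 i *: b`_i) b`_j.
  rewrite (scalar_vbasisE (killing_scalarl b`_j)) mxE; apply: eq_bigr => i _.
  by rewrite mxE coord_sum_free // (basis_free (vbasisP _)).
have gram_unit : gram \in unitmx.
  rewrite -row_free_unit; apply: inj_row_free => v /rowP v0.
  pose x := \sum_i v 0 i *: b`_i.
  have x0 : x = 0.
    apply: (herm_eq0 kP); rewrite /herm (scalar_vbasisE (killing_scalarr x)).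
    by apply: big1 => i _; have := v0 i; rewrite gramE mxE => ->; rewrite mulr0.
  apply/rowP=> i; rewrite mxE.
  have := coord_sum_free (fun i => v 0 i) i (basis_free (vbasisP {:g})).
  by rewrite -/b -/x x0 coord_0 => <-.
pose w := (\row_j f b`_j) *m invmx gram.
exists (conjk k (\sum_i w 0 i *: b`_i)) => x; rewrite /herm (conjkK kP).
rewrite (scalar_vbasisE lf) (scalar_vbasisE (killing_scalarl _)).
apply: eq_bigr => j _; congr (_ * _).
by rewrite killingC -gramE mulmxKV // mxE.
Qed.

(* On [imaginary_form k], [herm k x x] is [killing x x]. *)
Lemma cnorm_herm_bound : exists2 C, 0 <= C & forall x,
  cnorm phi x ^+ 2 <= C * complex.Re (herm k x x).
Proof.
have lc i : scalar (fun x => phi x 0 i).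
  by move=> a x y; rewrite linearP !mxE.
(* Each coordinate is represented by a vector y_i and bounded by Cauchy-Schwarz; the norm equals
   some coordinate modulus or is 0, so a sum over i serves as constant. *)
pose y i := projT1 (cid (herm_riesz (lc i))).
have yE i x : phi x 0 i = herm k x (y i).
  by rewrite /y; case: (cid _).
have re0 x : 0 <= complex.Re (herm k x x).
  have [->|/(herm_gt0 kP)] := eqVneq x 0; first by rewrite herm0r.
  by rewrite ltcE /= => /andP[_ /ltW].
exists (\sum_i complex.Re (herm k (y i) (y i))); first by rewrite sumr_ge0.
move=> x; have [->|[i ->]] := cnorm_coord phi x.
  by rewrite expr0n /= mulr_ge0 // sumr_ge0.
rewrite yE; apply: le_trans (herm_cauchy_schwarz _ _) _; rewrite mulrC.
by rewrite ler_wpM2r // (bigD1 i) //= lerDl sumr_ge0.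
Qed.

End HermitianBound.

(** * Moore-Penrose orbits *)

(** Here a, r, q are the norms of an isotropic eta, of rho, and of theta = eta + rho, on which the
    form is definite. If a exceeded (4D + 2) r, then a^2 <= 2 q^2 + 2 r^2 would contradict the bound
    on q. *)
Lemma isotropic_absorb (R : realFieldType) (D a r q : R) :
  0 <= D -> 0 <= r -> 0 <= q -> a <= q + r ->
  q ^+ 2 <= D * (2 * a * r + r ^+ 2) -> a <= (4 * D + 2) * r.
Proof.
move=> D0 r0 q0 aqr qD; rewrite leNgt; apply/negP => ar.
have a0 : 0 < a by apply: le_lt_trans ar; nra.
have aa : a ^+ 2 <= 2 * q ^+ 2 + 2 * r ^+ 2.
  have : a ^+ 2 <= (q + r) ^+ 2 by rewrite ler_pXn2r // nnegrE; lra.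
  by have := sqr_ge0 (q - r); nra.
have h1 : a * (2 * r) < a * (a - 4 * D * r) by rewrite ltr_pM2l //; lra.
have h2 : ((4 * D + 2) * r) * (2 * r) <= a * (2 * r).
  by apply: ler_wpM2r; lra.
have h3 : 0 <= D * r ^+ 2 by rewrite mulr_ge0 // sqr_ge0.
have h4 := sqr_ge0 r.
nra.
Qed.

(* In [Moore_Penrose_cube0], [a], [r], [z] are the norms of [eta], [rho], [zeta],
   [s] is |t| and [w] is the norm of j [e, u]. *)
Lemma first_order_estimate (R : realFieldType) (D Cu N B Ce w eps s a r z : R) :
  0 <= D -> 0 <= Cu -> 0 <= N -> 0 <= B -> 0 <= Ce -> 0 <= a ->
  0 < s -> s <= eps -> eps <= 1 ->
  (4 * D + 2) * (N + Cu) * eps <= 2^-1 ->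
  a <= (4 * D + 2) * r ->
  r <= eps * s + N * (eps * s) * z + s * (Cu * z) ->
  z <= a + s * B -> s * w <= Ce * a ->
  w <= 2 * (4 * D + 2) * Ce * (1 + (N + Cu) * B) * eps.
Proof.
move=> D0 Cu0 N0 B0 Ce0 a0 s0 se e1 small aEr rle zle swle.
set E := 4 * D + 2 in small aEr *; set Q := N + Cu in small *.
have E0 : 0 <= E by rewrite /E; lra.
have Q0 : 0 <= Q by rewrite /Q; lra.
have eps0 : 0 <= eps by lra.
have ses : 0 <= eps * s by rewrite mulr_ge0 // ltW.
have z1 : N * (eps * s) * z <= N * eps * a + N * (eps * s) * B.
  have i1 : N * (eps * s) * z <= N * (eps * s) * (a + s * B).
    by rewrite ler_wpM2l // mulr_ge0.
  have i2 : N * (eps * s) * (a + s * B) = (N * eps * a) * s + (N * (eps * s) * B) * s by ring.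
  have i3 : (N * eps * a) * s <= N * eps * a.
    by rewrite ler_piMr ?mulr_ge0 //; lra.
  have i4 : (N * (eps * s) * B) * s <= N * (eps * s) * B.
    by rewrite ler_piMr ?mulr_ge0 //; lra.
  lra.
have z2 : s * (Cu * z) <= Cu * eps * a + Cu * (eps * s) * B.
  have i1 : s * (Cu * z) <= s * (Cu * (a + s * B)).
    by rewrite ler_wpM2l ?(ltW s0) // ler_wpM2l.
  have i2 : s * (Cu * (a + s * B)) = s * (Cu * a) + s * (Cu * s * B) by ring.
  have i3 : s * (Cu * a) <= eps * (Cu * a) by rewrite ler_wpM2r // mulr_ge0.
  have i4 : s * (Cu * s * B) <= eps * (Cu * s * B).
    by rewrite ler_wpM2r // !mulr_ge0 // ltW.
  have -> : Cu * eps * a = eps * (Cu * a) by ring.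
  have -> : Cu * (eps * s) * B = eps * (Cu * s * B) by ring.
  lra.
have rle2 : r <= eps * s * (1 + Q * B) + Q * eps * a.
  have -> : eps * s * (1 + Q * B) + Q * eps * a
     = eps * s + (N * eps * a + N * (eps * s) * B) + (Cu * eps * a + Cu * (eps * s) * B).
    by rewrite /Q; ring.
  lra.
(* [small] bounds the coefficient of a by 1/2, so that term is absorbed on the left in [ale2]. *)
have ale : a <= E * (eps * s * (1 + Q * B)) + 2^-1 * a.
  have i1 : E * r <= E * (eps * s * (1 + Q * B) + Q * eps * a) by rewrite ler_wpM2l.
  have i2 : E * (Q * eps * a) <= 2^-1 * a.
    have -> : E * (Q * eps * a) = E * Q * eps * a by ring.
    by rewrite ler_wpM2r.
  rewrite mulrDr in i1; lra.
have ale2 : a <= 2 * (E * (eps * s * (1 + Q * B))) by lra.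
(* The remaining bound is proportional to eps * s; cancelling s leaves w = O(eps). *)
have : s * w <= s * (2 * E * Ce * (1 + Q * B) * eps).
  have -> : s * (2 * E * Ce * (1 + Q * B) * eps)
     = Ce * (2 * (E * (eps * s * (1 + Q * B)))) by ring.
  by apply: le_trans swle _; rewrite ler_wpM2l.
by rewrite ler_pM2l.
Qed.

Lemma Re_le_normc (R : realType) (a : R[i]) : complex.Re a <= normc a.
Proof.
case: a => u v /=; apply: le_trans (ler_norm u) _.
by rewrite -sqrtr_sqr ler_wsqrtr // lerDl sqr_ge0.
Qed.

Section MoorePenrose.
Variables (R : realType) (n : nat) (G : groupTopologicalType).
Variables (A : set (chart G 'rV[R[i]]_n)) (g : lieAlgebra R[i]).
Variables (T : Lie_algebra_of A g) (k : set g).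
Hypotheses (GA : complex_Lie_group A) (kP : compact_real_form k).
Implicit Types (e h f u x y z : g).
Local Notation N := (cnorm (to_tangent T)).
Let TB := to_tangent_bij T.

Lemma Ad_first_order_family (I : finType) u (y : I -> g) (eps : R) : 0 < eps ->
  exists a (t : R[i]), [/\ 0 < normc t, normc t <= eps &
    forall i, N (Ad T a (y i) - y i - t *: lie u (y i)) <= eps * normc t].
Proof.
move=> eps0; have epsC0 : 0 < eps%:C by rewrite (ltcR 0).
have del i := cid2 (Ad_first_order T u (y i) epsC0).
pose d i := s2val (del i).
have d0 i : 0 < d i by exact: (s2valP (del i)).
(* 1/S serves as a common t: S exceeds every 1/d_i and 1/eps. *)
pose S := \sum_i (d i)^-1 + eps%:C^-1 + 1.
have S0 : 0 < S.
  rewrite ltr_wpDl // addr_ge0 ?invr_ge0 ?(ltW epsC0) // sumr_ge0 // => i _.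
  by rewrite invr_ge0 ltW.
have St : 0 < S^-1 by rewrite invr_gt0.
have Sn : `|S^-1| = S^-1 by rewrite gtr0_norm.
exists (chart_inv (chart1 T) (S^-1 *: to_tangent T u + chart1 T 1%g)), S^-1.
have nE : (normc S^-1)%:C = S^-1 by rewrite -[RHS]Sn.
split.
- by rewrite -(ltcR 0) nE.
- rewrite -lecR nE invf_ple ?posrE //.
  rewrite /S -addrA addrC addrAC -addrA lerDl addr_ge0 // sumr_ge0 // => i _.
  by rewrite invr_ge0 ltW.
move=> i; rewrite -lecR rmorphM /= nE -cnormE -[in X in _ <= X]Sn.
apply: (s2valP' (del i)); rewrite Sn invf_plt ?posrE //.
rewrite /S (bigD1 i) //= -!addrA ltrDl ltr_wpDl ?sumr_ge0 // => [j _|].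
  by rewrite invr_ge0 ltW.
by rewrite ltr_wpDl // invr_ge0 ltW.
exact: d0.
Qed.

(** As h is hermitian, ad(h) + m is self-adjoint and g is the sum of its image and kernel. ad(e)^m
    kills the image by [iter_top_weight], so the kernel component of y keeps a nonzero ad(e)^m. *)
Lemma weight_top_vector e h f m : sl2_triple e h f -> imaginary_form k h ->
  (forall x, iter m.+1 (lie e) x = 0) -> (exists x, iter m (lie e) x != 0) ->
  exists2 x, lie h x = (- m%:R) *: x & iter m (lie e) x != 0.
Proof.
move=> [ef he _] /(imaginary_formP kP) hk em [y ey].
pose D : 'End(g) := (linfun (lie h) + m%:R *: \1)%VF.
have DE x : D x = lie h x + m%:R *: x.
  by rewrite /D add_lfunE scale_lfunE id_lfunE lfunE.
have DD x z : herm k (D x) z = herm k x (D z).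
  rewrite !DE /herm (conjkD kP) (conjkZ kP) conjc_nat killingDl (killingDr x).
  rewrite killingZl (killingZr _ x); congr (_ + _).
  by rewrite -[LHS]/(herm k (lie h x) z) (herm_lie kP) hk.
have [w [x [yE Dx]]] := adjoint_decomposition kP DD y.
exists x.
  by move/eqP: Dx; rewrite DE addr_eq0 scaleNr => /eqP.
by move: ey; rewrite yE iter_lieD DE (iter_top_weight ef he em) add0r.
Qed.

Lemma killing_sqrD x y :
  killing (x + y) (x + y) = killing x x + 2 * killing x y + killing y y.
Proof. by rewrite killingDl !killingDr (killingC y x); ring. Qed.

Lemma killing_iter e m x y :
  killing (iter m (lie e) x) y = (-1) ^+ m * killing x (iter m (lie e) y).
Proof.
elim: m y => [|m IHm] y; first by rewrite expr0 mul1r.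
by rewrite iterS killing_lie IHm -iterSr exprS mulN1r mulNr.
Qed.

Lemma Moore_Penrose_cube0 e h f : sl2_triple e h f -> imaginary_form k h ->
  ad_nilpotent e ->
  (forall a, exists h' f', sl2_triple (Ad T a e) h' f' /\ imaginary_form k h') ->
  forall x, lie e (lie e (lie e x)) = 0.
Proof.
move=> tri hk [m0 em0] MP.
have exm : exists m, `[< forall x, iter m (lie e) x = 0 >] by exists m0; apply/asboolP.
case: (ex_minnP exm) => m /asboolP em mmin.
have [m3|] := leqP m 3; first exact: (iter_lie_eq0 em m3).
(* The minimal m is the first vanishing power. It is now p + 4, so the last nonzero power is p + 3
   and u below has weight - (p + 3) + 2 (p + 2) = p + 1 > 0. *)
case: m em mmin => [//|[//|[//|[//|p]]]] em mmin _; exfalso.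
have [|x hx ex] := @weight_top_vector e h f p.+3 tri hk em.
  apply: contrapT => /forallNP ne; have := mmin p.+3; rewrite ltnn => /(_ _)/negP; apply=> //.
  by apply/asboolP => x; have /negP := ne x; rewrite negbK => /eqP.
pose u := iter p.+2 (lie e) x; pose j : R[i] := p.+1%:R.
have [ef he hf] := tri.
have eu : lie e u != 0 by [].
have hu : lie h u = j *: u.
  rewrite /u (weight_iter _ he hx); congr (_ *: _).
  by rewrite /j -[in LHS](addn3 p) -[in LHS](addn2 p) -(addn1 p) !natrD; ring.
have Ku z : lie e z = 0 -> killing z u = 0.
  by move=> ez; rewrite /u iterS killingC killing_lie ez killing0r oppr0.
(* By invariance this involves ad(e)^(2p+4) x, and 2p + 4 >= p + 4. *)
have Kuu : killing u u = 0.
  rewrite killing_iter /u -iterD (iter_lie_eq0 em) ?killing0r ?mulr0 //.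
  by rewrite !addSn !addnS !ltnS leq_addr.
have hkE := (imaginary_formP kP h).1 hk.
have [Cu Cu0 CuP] := cnorm_linear_bound TB (lie u).
have [Ce Ce0 CeP] := cnorm_linear_bound TB (lie e).
have [CK CK0 CKP] := cnorm_bilinear_bound TB (B := @killing _ g)
  (fun y => killing_scalarl y) (fun x => killing_scalarr x).
have [CL CL0 CLP] := cnorm_herm_bound kP (to_tangent T).
pose D := CL * CK; have D0 : 0 <= D by rewrite mulr_ge0.
pose B := normc j * N u.
have B0 : 0 <= B by rewrite mulr_ge0 ?normc_ge0 ?cnorm_ge0.
pose w := normc j * N (lie e u).
have w0 : 0 < w.
  rewrite mulr_gt0 // lt_neqAle eq_sym.
    rewrite normc_ge0 andbT; apply/eqP => /eq0_normc /eqP.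
    by rewrite pnatr_eq0.
  rewrite cnorm_ge0 andbT; apply: contra eu => /eqP /(cnorm_eq0 TB) ->.
  exact: eqxx.
pose H := 2 * (4 * D + 2) * Ce * (1 + (n%:R + Cu) * B).
have Q0 : 0 <= n%:R + Cu by rewrite addr_ge0.
have H0 : 0 <= H.
  have DD : 0 <= 4 * D + 2 by rewrite addr_ge0 // mulr_ge0.
  have QB : 0 <= 1 + (n%:R + Cu) * B by rewrite addr_ge0 // mulr_ge0.
  by rewrite /H mulr_ge0 // mulr_ge0 // mulr_ge0.
have key (eps : R) : 0 < eps -> eps <= 1 ->
    (4 * D + 2) * (n%:R + Cu) * eps <= 2^-1 -> w <= H * eps.
  move=> eps0 eps1 small.
  (* One t serves both for h ([None]) and for a basis ([Some i]); the latter controls Ad(a) on zeta,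
     which itself depends on a. *)
  have [a [t [t0 te aP]]] := Ad_first_order_family u
    (fun o : option 'I_n => if o is Some i then cbasis (to_tangent T) i else h) eps0.
  have [h' [f' [[ef' he' hf'] /(imaginary_formP kP) hk']]] := MP a.
  (* The triple at Ad(a) e is pulled back to e, where neutral elements differ by an element of both
     ker ad(e) and im ad(e). *)
  pose zeta := Ad T a^-1%g h' - h.
  have Adh' : Ad T a (Ad T a^-1%g h') = h' := AdVK T GA a h'.
  have eh' : lie e (Ad T a^-1%g h') = - 2 *: e.
    rewrite -{1}(AdK T GA a e) -(Ad_lie T GA) lieC he' -scaleNr linearZ /=.
    by rewrite (AdK T GA).
  have ezeta : lie e zeta = 0.
    by rewrite lieBr eh' (lieC e h) he scaleNr subrr.
  have zetaE : zeta = lie e (Ad T a^-1%g f' - f).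
    by rewrite lieBr ef -{1}(AdK T GA a e) -(Ad_lie T GA) ef'.
  have Kzz : killing zeta zeta = 0.
    by rewrite {1}zetaE killing_lie ezeta killing0r oppr0.
  have Kzu := Ku _ ezeta.
  (* The first-order part of h' - h. It is isotropic: zeta lies in ker ad(e), zeta and u lie in im
     ad(e), and K(u, u) = 0. *)
  pose eta := zeta - (t * j) *: u.
  have Kee : killing eta eta = 0.
    rewrite /eta -scaleNr killing_sqrD Kzz killingZl !killingZr Kuu Kzu.
    by ring.
  pose theta := h' - h; pose rho := theta - eta.
  have thetaE : theta = eta + rho by rewrite addrC subrK.
  (* From h' = Ad(a)(h + zeta) and [u, h] = - j u: the two parentheses are first-order
     remainders. *)
  have rhoE : rho = (Ad T a h - h - t *: lie u h)
      + (Ad T a zeta - zeta - t *: lie u zeta) + t *: lie u zeta.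
    have -> : Ad T a zeta = h' - Ad T a h by rewrite linearB /= Adh'.
    by rewrite (lieC u h) hu /rho /theta /eta; coord_ring.
  have rho_le : N rho <= eps * normc t + n%:R * (eps * normc t) * N zeta
      + normc t * (Cu * N zeta).
    pose Lf z := Ad T a z - z - t *: lie u z.
    have Ll : linear Lf.
      move=> c y z; rewrite /Lf linearP lieDr lieZr; coord_ring.
    pose L : {linear g -> g} := HB.pack Lf (GRing.isLinear.Build _ _ _ _ _ Ll).
    rewrite rhoE; apply: le_trans (cnormD _ _ _) _; apply: lerD.
      apply: le_trans (cnormD _ _ _) _; apply: lerD; first exact: (aP None).
      apply: (cnorm_linear_le TB (L := L)) => i; exact: (aP (Some i)).
    by rewrite cnormZ ler_wpM2l ?normc_ge0 ?CuP.
  have theta_le : N theta ^+ 2 <= D * (2 * N eta * N rho + N rho ^+ 2).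
    apply: le_trans (CLP theta) _; rewrite /D -mulrA ler_wpM2l //.
    (* theta is hermitian, so its square norm is K(theta, theta), where K(eta, eta) drops out. *)
    have -> : herm k theta theta = 2 * killing eta rho + killing rho rho.
      rewrite /herm (conjkB kP) hk' hkE -/theta thetaE killing_sqrD Kee add0r.
      exact: erefl.
    apply: le_trans (Re_le_normc _) _; apply: le_trans (le_normcD _ _) _.
    rewrite normcM mulrDr; apply: lerD.
      have -> : normc (2 : R[i]) = 2.
        by apply: complexI; rewrite -normcE_normr normr_nat rmorph_nat.
      have -> : CK * (2 * N eta * N rho) = 2 * (CK * N eta * N rho) by ring.
      by rewrite ler_wpM2l.
    by rewrite expr2 mulrA.
  have eta_le : N eta <= N theta + N rho.
    have -> : eta = theta + (- 1) *: rho by rewrite thetaE; coord_ring.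
    apply: le_trans (cnormD _ _ _) _; rewrite lerD2l cnormZ.
    by rewrite normcN normc1 mul1r.
  have zeta_le : N zeta <= N eta + normc t * B.
    have -> : zeta = eta + (t * j) *: u by rewrite /eta subrK.
    apply: le_trans (cnormD _ _ _) _; rewrite {1}/eta -/eta lerD2l cnormZ.
    by rewrite normcM /B mulrA.
  have w_le : normc t * w <= Ce * N eta.
    rewrite /w mulrA -normcM -cnormZ.
    have -> : (t * j) *: lie e u = lie e ((- 1) *: eta).
      by rewrite lieZr /eta -scaleNr (lieDr e zeta) ezeta lieZr; coord_ring.
    by apply: le_trans (CeP _) _; rewrite cnormZ normcN normc1 mul1r.
  have eta_le2 := isotropic_absorb D0 (cnorm_ge0 _ _) (cnorm_ge0 _ _) eta_le theta_le.
  exact: (first_order_estimate D0 Cu0 (ler0n _ _) B0 Ce0 (cnorm_ge0 _ _) t0 te eps1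
    small eta_le2 rho_le zeta_le w_le).
pose E := (4 * D + 2) * (n%:R + Cu).
have E0 : 0 <= E by rewrite mulr_ge0 // addr_ge0 // mulr_ge0.
(* eps = 1/S satisfies both smallness conditions of [key], and (H + 1) eps < w contradicts its
   conclusion. *)
pose S := 1 + 2 * E + (H + 1) / w.
have HW : 0 < (H + 1) / w by rewrite divr_gt0 // ltr_wpDl.
have S0 : 0 < S by rewrite /S; lra.
have SV : S^-1 * (1 + 2 * E + (H + 1) / w) = 1 by rewrite mulVf // gt_eqF.
have V0 : 0 < S^-1 by rewrite invr_gt0.
have SE : S^-1 + 2 * (E * S^-1) + (H + 1) * S^-1 / w = 1.
  by rewrite -[RHS]SV; ring.
have i1 : 0 <= E * S^-1 by rewrite mulr_ge0 // ltW.
have i2 : 0 < (H + 1) * S^-1 / w by rewrite divr_gt0 // mulr_gt0 // ltr_wpDl.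
have Hw : w <= H * S^-1 by apply: key => //; rewrite -?/E; lra.
have : (H + 1) * S^-1 / w < 1 by lra.
rewrite ltr_pdivrMr // mul1r; lra.
Qed.

Lemma iter_lie_Ad m a e x :
  iter m (lie (Ad T a e)) (Ad T a x) = Ad T a (iter m (lie e) x).
Proof. by elim: m => //= m ->; rewrite (Ad_lie T GA). Qed.

Lemma iter_lie_Ad_eq0 m a e : (forall x, iter m (lie e) x = 0) ->
  forall x, iter m (lie (Ad T a e)) x = 0.
Proof.
by move=> em x; rewrite -[x](AdVK T GA a) iter_lie_Ad em linear0.
Qed.

Lemma max_ad_power_exists e : e != 0 -> ad_nilpotent e -> exists m, max_ad_power e m.
Proof.
move=> e0 [m0 em0].
have exm : exists m, `[< forall x, iter m (lie e) x = 0 >] by exists m0; apply/asboolP.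
case: (ex_minnP exm) => m /asboolP em mmin.
case: m em mmin => [e_0|m em mmin]; first by move: e0; rewrite (e_0 e : e = 0) eqxx.
exists m; split.
  apply: contrapT => /forallNP ne; have := mmin m; rewrite ltnn => /(_ _)/negP; apply=> //.
  by apply/asboolP => x; have /negP := ne x; rewrite negbK => /eqP.
move=> m' [x]; apply: contra_neqT; rewrite -ltnNge => mm'.
exact: (iter_lie_eq0 em mm').
Qed.

End MoorePenrose.

Theorem theorem2 (R : realType) (n : nat) (G : groupTopologicalType)
    (A : set (chart G 'rV[R[i]]_n)) (g : lieAlgebra R[i])
    (T : Lie_algebra_of A g) (k Orb : set g) :
  complex_Lie_group A ->
  connected [set: G] ->
  simply_connected R G ->
  simple_Lie_algebra g ->
  compact_real_form k ->
  nilpotent_orbit T Orb ->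
  Orb <> [set 0] ->
  (Moore_Penrose k Orb <-> ht Orb = 2%N) /\
  (Moore_Penrose k Orb -> forall e, Orb e ->
     exists! p : g * g, sl2_triple e p.1 p.2 /\ imaginary_form k p.1).
Proof.
move=> GA _ _ _ kP [e0 nil0 OrbE] Orb0.
have orbP y : Orb y <-> exists a, y = Ad T a e0 by rewrite OrbE; apply: Ad_orbitP.
have e0n0 : e0 != 0.
  apply/eqP => e00; apply: Orb0; apply/seteqP; split=> y.
    by move=> /orbP[a ->]; rewrite e00 linear0.
  by move=> ->; apply/orbP; exists 1%g; rewrite e00 linear0.
have orb_n0 e : Orb e -> e != 0.
  move=> /orbP[a ->]; apply: contra_neq e0n0 => ae0.
  by rewrite -(AdK T GA a e0) ae0 linear0.
have orb_Ad e a : Orb e -> Orb (Ad T a e).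
  by move=> /orbP[b ->]; apply/orbP; exists (a * b)%g; rewrite (AdM T GA).
have orb_trans e e' : Orb e -> Orb e' -> exists a, e' = Ad T a e.
  move=> /orbP[a ->] /orbP[b ->]; exists (b * a^-1)%g.
  by rewrite (AdM T GA) (AdK T GA).
have orb_nil e : Orb e -> ad_nilpotent e.
  move=> /orbP[a ->]; have [m em] := nil0; exists m.
  exact: (iter_lie_Ad_eq0 T GA).
have orb_e0 : Orb e0 by apply/orbP; exists 1%g; rewrite Ad1.
have cube0 : Moore_Penrose k Orb -> forall e, Orb e ->
    forall x, lie e (lie e (lie e x)) = 0.
  move=> MP e Oe; have [h [f [tri hk]]] := MP e Oe.
  apply: (Moore_Penrose_cube0 GA kP tri hk (orb_nil e Oe)) => a.
  exact: MP (orb_Ad _ _ Oe).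
(* A maximal power exists at [e0], so the [get] in [ht] is taken over a nonempty set. *)
have ht_attained : exists2 e, Orb e & max_ad_power e (ht Orb).
  apply: (@getPex _ [set m | exists2 e, Orb e & max_ad_power e m]).
  by have [m em] := max_ad_power_exists e0n0 nil0; exists m, e0.
split; [split|].
- move=> MP; have [e Oe [[x ex] emax]] := ht_attained.
  have [h [f [[ef he hf] hk]]] := MP e Oe.
  apply/eqP; rewrite eqn_leq; apply/andP; split.
    rewrite leqNgt; apply: contra ex => lt2.
    by apply/eqP; apply: (@iter_lie_eq0 _ _ 3 _ e (cube0 MP e Oe) lt2).
  (* The height is at least 2 because ad(e)^2 f = [e, h] = - 2e is nonzero. *)
  apply: emax; exists f; rewrite /= ef lieC he oppr_eq0 scaler_eq0 pnatr_eq0.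
  exact: orb_n0.
(* The vanishing of ad(e')^3 is read off at the point where [ht] is attained, then carried to e by
   Ad. *)
- move=> ht2 e Oe; have [e' Oe' [_ emax]] := ht_attained.
  have e'3 x : iter 3 (lie e') x = 0.
    apply/eqP/negPn/negP => e'x; have := emax 3 (ex_intro _ x e'x).
    by rewrite ht2.
  apply: (hermitian_triple kP); have [a ->] := orb_trans _ _ Oe' Oe.
  by move=> x; have /= := iter_lie_Ad_eq0 T GA a e'3 x.
move=> MP e Oe; have [h [f [tri hk]]] := MP e Oe.
exists (h, f); split=> // -[h' f'] /= [tri' hk'].
by have [-> ->] := hermitian_triple_unique kP (cube0 MP e Oe) tri hk tri' hk'.
Qed.
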